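(* Let $\xi$ be a non-negative integer-valued random variable with $\mathbb{E}\xi=1$ and $0<\mathrm{Var}(\xi)<\infty$, let $\mathcal{T}$ be the Galton-Watson tree with offspring distribution $\xi$, and let $\mathcal{T}_n$ be $\mathcal{T}$ conditioned on $|\mathcal{T}|=n$. Let $\mathcal{S}^+_{\le k}$ be the set of plane trees $T$ with $|T|\le k$ and $\mathbb{P}(\mathcal{T}=T)>0$, and let $p^{\min}_k:=\min_{T\in\mathcal{S}^+_{\le k}}\mathbb{P}(\mathcal{T}=T)$. Assume that, as $k\to\infty$, $$\log(1/p^{\min}_k)\sim\gamma k^{\alpha}(\log k)^{\beta},$$ where $\alpha\ge1$, $\beta\ge0$, $\gamma>0$ are constants. Let $k_n\to\infty$ be a sequence of positive integers and let $m=\log n$. Then for all constants $\delta>0$: (i) if $k_n\le(1-\delta)\left[\dfrac{m}{\gamma(\log m^{1/\alpha})^{\beta}}\right]^{1/\alpha}$, then with high probability $\mathcal{T}_n$ contains all trees in $\mathcal{S}^+_{\le k_n}$ as fringe subtrees; (ii) if $k_n\ge(1+\delta)\left[\dfrac{m}{\gamma(\log m^{1/\alpha})^{\beta}}\right]^{1/\alpha}$, then with high probability $\mathcal{T}_n$ does not contain all trees in $\mathcal{S}^+_{\le k_n}$ as fringe subtrees. As a result, with $K_n:=\max\{k:\text{every tree in }\mathcal{S}^+_{\le k}\text{ is a fringe subtree of }\mathcal{T}_n\}$, $$\frac{K_n}{\left(\log n/(\log\log n)^{\beta}\right)^{1/\alpha}}\to\left(\frac{\alpha^{\beta}}{\gamma}\right)^{1/\alpha}\quad\text{in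 probability.}$$
   Context: A plane tree is a finite rooted, ordered, unlabeled tree; $|T|$ is its number of nodes. For a node $v$ of $T$, the fringe subtree $T_v$ consists of $v$ and all its descendants; $T$ contains $T'$ as a fringe subtree if $T_v$ is isomorphic (as a plane tree) to $T'$ for some $v$. The Galton-Watson tree is generated from the root by giving each node independently a number of children distributed as $\xi$. Let $p_i=\mathbb{P}(\xi=i)$ and $h=\gcd\{i\ge1:p_i>0\}$; then $\mathbb{P}(|\mathcal{T}|=n)>0$ for all large $n\equiv1\pmod h$, and all limits as $n\to\infty$ are along such $n$. ''With high probability'' means with probability tending to $1$ as $n\to\infty$. *)

(* Defs.v *)
From HB Require Import structures.
From mathcomp Require Import all_boot all_order all_algebra.
From mathcomp Require Import all_classical all_reals all_analysis.

Set Implicit Arguments.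
Unset Strict Implicit.
Unset Printing Implicit Defensive.

Import Order.TTheory GRing.Theory Num.Theory.
Import numFieldNormedType.Exports.

Local Open Scope classical_set_scope.
Local Open Scope ring_scope.

(* Isomorphism of plane trees is Leibniz equality on this type. *)
Inductive plane_tree := Node of seq plane_tree.

Definition children (t : plane_tree) : seq plane_tree :=
  let: Node ts := t in ts.

Fixpoint tree_size (t : plane_tree) : nat :=
  let: Node ts := t in (sumn (map tree_size ts)).+1.

(* Nodes are addressed by Ulam-Harris words: [::] is the root and rcons v i is
   the (i+1)-st child of v.  fringe t v is the fringe subtree of t at the node
   v, or None when v is not a node of t. *)
Fixpoint fringe (t : plane_tree) (v : seq nat) : option plane_tree :=
  if v is i :: w then
    if onth (children t) i is Some c then fringe c w else None
  else Some t.

Definition tree_nodes (t : plane_tree) : set (seq nat) :=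
  [set v | exists s, fringe t v = Some s].

Definition contains_fringe (t s : plane_tree) : Prop :=
  exists v, fringe t v = Some s.

Definition mutually_independent d (Omega : measurableType d) (R : realType)
    (P : probability Omega R) (I : choiceType) (X : I -> {RV P >-> nat}) :=
  forall (s : seq I) (A : I -> set nat), uniq s ->
    P (\bigcap_(i in [set` s]) (X i @^-1` A i)) =
    (\prod_(i <- s) P (X i @^-1` A i))%E.

(* X is a family of independent copies of xi indexed by Ulam-Harris words. *)
Definition offspring_family d (Omega : measurableType d) (R : realType)
    (P : probability Omega R) (xi : {RV P >-> nat})
    (X : seq nat -> {RV P >-> nat}) :=
  mutually_independent X /\
  forall u, distribution P (X u) = distribution P xi.

Section GaltonWatson.
Context d (Omega : measurableType d) (R : realType) (P : probability Omega R).
Variable X : seq nat -> {RV P >-> nat}.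

(* The node set of the Galton-Watson tree in which the word v, if it is a node,
   has X v children; it may be infinite. *)
Definition gw_nodes (w : Omega) : set (seq nat) :=
  [set u | forall j, (j < size u)%N -> (nth 0%N u j < X (take j u) w)%N].

(* The event that the Galton-Watson tree is (finite and) a member of A. *)
Definition gw_event (A : set plane_tree) : set Omega :=
  [set w | exists2 t, A t & gw_nodes w = tree_nodes t].

Definition gw_prob (A : set plane_tree) : R := fine (P (gw_event A)).

(* The law of the Galton-Watson tree conditioned to have n nodes. *)
Definition gw_cond (n : nat) (A : set plane_tree) : R :=
  gw_prob (A `&` [set t | tree_size t = n]) /
  gw_prob [set t | tree_size t = n].

Definition Splus (k : nat) : set plane_tree :=
  [set t | (tree_size t <= k)%N /\ 0 < gw_prob [set t]].

(* Minimum over a finite set, nonempty for k >= 1 when P (xi = 0) > 0;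
   the value is 0 when there is no minimum. *)
Definition pmin (k : nat) : R :=
  let A := [set gw_prob [set t] | t in Splus k] in xget 0 (A `&` lbound A).

Definition contains_all (k : nat) (t : plane_tree) : Prop :=
  forall s, Splus k s -> contains_fringe t s.

(* The maximum k such that contains_all k t; 0 when there is no maximum. *)
Definition Kmax (t : plane_tree) : nat :=
  let A := [set k | contains_all k t] in xget 0%N (A `&` ubound A).

End GaltonWatson.

Definition is_gcd_set (A : set nat) (h : nat) : Prop :=
  (forall i, A i -> (h %| i)%N) /\
  (forall g, (forall i, A i -> (g %| i)%N) -> (g %| h)%N).

(* n tending to infinity along n = 1 mod h. *)
Definition infty_mod1 (h : nat) : set_system nat :=
  within [set n | n = 1 %[mod h]] \oo.

Definition threshold (R : realType) (alpha beta gamma : R) (n : nat) : R :=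
  let m := ln n%:R in
  (m / (gamma * (ln (m `^ alpha^-1)) `^ beta)) `^ alpha^-1.

(* Main.v *)
Require Import Defs.
From HB Require Import structures.
From mathcomp Require Import all_boot all_order all_algebra.
From mathcomp Require Import all_classical all_reals all_analysis.
From mathcomp Require Import zify ring lra.

Set Implicit Arguments.
Unset Strict Implicit.
Unset Printing Implicit Defensive.

Import Order.TTheory GRing.Theory Num.Theory.
Import numFieldNormedType.Exports.

Local Open Scope classical_set_scope.
Local Open Scope ring_scope.

(** Write w(t) for the probability of a tree t, a_n for the probability of having
n nodes, q_k for the least positive w(t) with t of at most k nodes, and theta for
the threshold.

Everything rests on three facts about the depth-first exploration of a forest,
all proved by the same one-step recursion (remove the first root, put its
children in front).

- A fringe subtree with k nodes is distributed as the tree conditioned on having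
  k nodes, and there are at most n such subtrees. Hence T_n contains a given tree T
  of k nodes with probability at most n w(T) / a_k (containing_weight_le).

- The preorder degree sequence of a tree that avoids T is never equal to the code
  of T on any of its n / |T| blocks of length |T|, and the degrees are independent.
  Hence the probability of having n nodes and avoiding T is at most
  (1 - w(T)) ^ (n / |T|) (avoiding_weight_le).

- Replacing the last leaf by another tree gives a_(n+1) a_(m+1) <= a_(n+m+1)
  (total_weight_supermul).

Both estimates become useful through a lower bound for a_n: for every eps > 0 there
is C such that a_n >= exp (- C n ^ eps) whenever a_n is positive
(total_weight_subexp). To get it, let y be the generating
function of the size, so that y(s) = s f(y(s)) with f the generating function of
the offspring law. Mean 1 and finite variance squeeze f(1 - u) between
1 - u + c u^2 and 1 - u + K u^2, so 1 - y(1 - 1/N) is of order N ^ (-1/2). Reading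
s = 1 - 1/N as killing each node with probability 1/N, this forces a polynomially
large a_n for some n in every window [N, A N] (size_window). Peeling such a size off
n, by supermultiplicativity, reduces n by a constant factor at a polynomial cost;
a logarithmic number of peelings costs less than a factor exp (C n ^ eps). The lattice
condition enters through the sizes minus one, which form an additive set with gcd h;
such a set contains all large multiples of h (additive_gcd_cofinite).

Now let m = ln n. Below the threshold, q_k >= n ^ (-1 + delta/2) by the assumption
on q_k, and at most 1 / q_k trees have to be covered since their probabilities add
up to at most 1. The union bound
1 / (q_k a_n) * exp (- q_k (n / k)) tends to 0, because k is of order at most m
(gw_cond_missing_cvg). Above the threshold, the least probable tree alone is missing
with high probability: n q_k exp (C k ^ (1/2)) tends to 0, because ln (1 / q_k)
exceeds (1 + delta/4) m and grows at least linearly in k (gw_cond_contains_all_cvg).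
The two regimes, applied to integers just above and just below the threshold,
locate the largest covered size. *)

(** * Plane forests, their enumeration and their preorder code *)

HB.instance Definition _ := gen_eqMixin plane_tree.
HB.instance Definition _ := gen_choiceMixin plane_tree.

Definition forest := seq plane_tree.

Definition fsize (f : forest) : nat := sumn (map tree_size f).

Lemma tree_size_gt0 t : (0 < tree_size t)%N.
Proof. by case: t. Qed.

Lemma fsize_cat f g : fsize (f ++ g) = (fsize f + fsize g)%N.
Proof. by rewrite /fsize map_cat sumn_cat. Qed.

Lemma fsize_cons t f : fsize (t :: f) = (tree_size t + fsize f)%N.
Proof. by []. Qed.

Lemma size_le_fsize f : (size f <= fsize f)%N.
Proof.
elim: f => // t f IH; rewrite fsize_cons /= -add1n.
exact: leq_add (tree_size_gt0 t) IH.
Qed.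

(** Read backwards, [grow d f |-> f] is one step of the depth-first exploration: the
first root is removed and its [d] children take its place. *)
Definition grow (d : nat) (f : forest) : forest :=
  Node (take d f) :: drop d f.

(** A forest of [j.+1] trees and [n.+1] nodes leaves, when its first root is removed,
one of [j + d] trees and [n] nodes, with [d <= n]. Thus the recursion is structural
in the number of nodes, and sums over forests obey a one-step recursion. *)
Fixpoint forests (j n : nat) {struct n} : seq forest :=
  match n, j with
  | 0, 0 => [:: [::]]
  | n'.+1, j'.+1 =>
      [seq grow d f | d <- iota 0 n'.+1, f <- forests (j' + d) n']
  | _, _ => [::]
  end.

Lemma mem_forests j n f :
  (f \in forests j n) = (size f == j) && (fsize f == n).
Proof.
elim: n j f => [|n IH] j f.
  have -> : (fsize f == 0%N) = (f == [::]).
    by case: f => // t f; rewrite fsize_cons addn_eq0 eqn0Ngt tree_size_gt0.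
  case: j => [|j] /=; first by rewrite mem_seq1; case: f.
  by rewrite in_nil; case: f => // t f; rewrite andbF.
case: j => [|j]; first by rewrite /= in_nil; case: f.
apply/allpairsPdep/andP.
- move=> [d [g [_]]]; rewrite IH => /andP[/eqP sg /eqP fg ->]; split.
    by rewrite /grow /= size_drop sg addnK.
  by rewrite /grow fsize_cons /= addSn eqSS -sumn_cat -map_cat cat_take_drop -fg.
- case: f => [[]//|[ts] rs] [/eqP[srs] /eqP fs].
  have fE : fsize (ts ++ rs) = n.
    by apply/succn_inj; rewrite -fs fsize_cat fsize_cons.
  exists (size ts), (ts ++ rs); split.
  + rewrite mem_iota /= add0n ltnS -fE fsize_cat.
    exact: leq_trans (size_le_fsize _) (leq_addr _ _).
  + by rewrite IH size_cat srs addnC fE !eqxx.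
  + by rewrite /grow take_size_cat // drop_size_cat.
Qed.

Lemma forests_uniq j n : uniq (forests j n).
Proof.
elim: n j => [|n IH] [|j] //=.
apply: (@allpairs_uniq_dep nat (fun=> forest) forest grow _ _
  (iota_uniq 0 n.+1) (fun d _ => IH (j + d)%N)).
move=> [d f] [e g] /allpairsPdep[d' [f' [_ + [dE fE]]]].
rewrite -dE in fE *; rewrite -{}fE mem_forests => /andP[/eqP sf _].
move=> /allpairsPdep[e' [g' [_ + [eE gE]]]].
rewrite -eE in gE *; rewrite -{}gE mem_forests => /andP[/eqP sg _] /= [te de].
have fg : f = g by rewrite -(cat_take_drop d f) te de cat_take_drop.
suff : d = e by move=> ->; rewrite fg.
have := congr1 size te; rewrite !size_takel ?sf ?sg ?leq_addl //.
Qed.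

(** The induction principle generated for [plane_tree] says nothing about the subtrees,
as they are nested in a list. *)
Section TreeInd.
Variable Q : plane_tree -> Prop.
Hypothesis QNode : forall ts, (forall t, t \in ts -> Q t) -> Q (Node ts).

Fixpoint plane_tree_nested_ind (t : plane_tree) : Q t :=
  match t with
  | Node ts => QNode (
      (fix all_ts (us : forest) : forall t, t \in us -> Q t :=
        match us return forall t, t \in us -> Q t with
        | [::] => fun t tin => match notF tin with end
        | u :: us' => fun t tin =>
            match predU1P (etrans (esym (in_cons u us' t)) tin) with
            | or_introl e => ecast z (Q z) (esym e) (plane_tree_nested_ind u)
            | or_intror tin' => all_ts us' t tin'
            end
        end) ts)
  end.
End TreeInd.


Lemma contains_fringe_Node ts T :
  contains_fringe (Node ts) T <->
  Node ts = T \/ exists2 t, t \in ts & contains_fringe t T.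
Proof.
split=> [[[|i v] /=]|].
- by case=> <-; left.
- case E: (onth ts i) => [c|] // cT; right; exists c; last by exists v.
  by apply/onthP; exists i.
- case=> [<-|[t /onthP[i ti] [v tv]]]; first by exists [::].
  by exists (i :: v); rewrite /= ti.
Qed.

Lemma contains_fringe_refl T : contains_fringe T T.
Proof. by exists [::]. Qed.

Definition fcontains (f : forest) (T : plane_tree) : Prop :=
  exists2 t, t \in f & contains_fringe t T.

Lemma fcontains_cat f g T :
  fcontains (f ++ g) T <-> fcontains f T \/ fcontains g T.
Proof.
split=> [[t]|]; first by rewrite mem_cat => /orP[] tf tT; [left|right]; exists t.
by case=> -[t tf tT]; exists t => //; rewrite mem_cat tf ?orbT.
Qed.

Lemma fcontains_seq1 t T : fcontains [:: t] T <-> contains_fringe t T.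
Proof.
split=> [[s]|tT]; first by rewrite mem_seq1 => /eqP ->.
by exists t; rewrite ?mem_seq1.
Qed.

Lemma fcontains_grow d f T :
  fcontains (grow d f) T <-> Node (take d f) = T \/ fcontains f T.
Proof.
rewrite /grow -cat1s fcontains_cat fcontains_seq1 contains_fringe_Node.
have := fcontains_cat (take d f) (drop d f) T.
by rewrite cat_take_drop => ->; rewrite /fcontains; tauto.
Qed.

(** The preorder sequence of outdegrees (Lukasiewicz word). *)
Fixpoint tree_code (t : plane_tree) : seq nat :=
  let: Node ts := t in size ts :: flatten (map tree_code ts).

Definition forest_code (f : forest) : seq nat := flatten (map tree_code f).

Lemma forest_code_cat f g : forest_code (f ++ g) = forest_code f ++ forest_code g.
Proof. by rewrite /forest_code map_cat flatten_cat. Qed.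

Lemma forest_code_Node ts f :
  forest_code (Node ts :: f) = size ts :: forest_code (ts ++ f).
Proof. by rewrite forest_code_cat. Qed.

Lemma forest_code_grow d f : (d <= size f)%N ->
  forest_code (grow d f) = d :: forest_code f.
Proof.
by move=> df; rewrite /grow forest_code_Node size_takel // cat_take_drop.
Qed.

Lemma size_forest_code f : size (forest_code f) = fsize f.
Proof.
move: {2}(fsize f) (leqnn (fsize f)) => n; elim: n f => [|n IH] [|[ts] f] //.
rewrite forest_code_Node fsize_cons addSn ltnS /= -/(fsize ts) -fsize_cat.
by move=> /IH ->.
Qed.

Lemma size_tree_code t : size (tree_code t) = tree_size t.
Proof.
by rewrite -[tree_code t]cats0 -[_ ++ _]/(forest_code [:: t]) size_forest_code
  /fsize /= addn0.
Qed.

(** The code is prefix-free: the first degree determines how many trees have to be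
decoded next, so a code at the beginning of a word is decoded in a single way. *)
Lemma forest_code_prefix f g r : (size g <= size f)%N ->
  forest_code f = forest_code g ++ r -> exists f', f = g ++ f'.
Proof.
move: {2}(fsize g) (leqnn (fsize g)) => n; elim: n f g => [|n IH] f [|[ts] g] //;
  try by exists f.
rewrite fsize_cons addSn ltnS -/(fsize ts) -fsize_cat => gn.
case: f => [//|[us] f]; rewrite ltnS => gf.
rewrite !forest_code_Node cat_cons => -[su].
have sz : (size (ts ++ g) <= size (us ++ f))%N by rewrite !size_cat su leq_add2l.
move=> /(IH _ _ gn sz)[f'].
rewrite -catA => /eqP; rewrite eqseq_cat // => /andP[/eqP -> /eqP ->].
by exists f'.
Qed.

Lemma forest_code_head f T r : (0 < size f)%N ->
  forest_code f = tree_code T ++ r -> exists f', f = T :: f'.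
Proof.
move=> f0 fT; apply: (@forest_code_prefix f [:: T] r f0).
by rewrite fT /forest_code /= cats0.
Qed.

(** * Weights of forests under an offspring law *)

Section Weights.
Variables (R : realType) (p : nat -> R).
Hypothesis p_ge0 : forall i, 0 <= p i.
Hypothesis sum_p_le1 : forall N, \sum_(i < N) p i <= 1.

(** The probability of [t] under the Galton-Watson law with offspring distribution [p]. *)
Fixpoint tree_weight (t : plane_tree) : R :=
  let: Node ts := t in p (size ts) * \prod_(x <- map tree_weight ts) x.

Definition forest_weight (f : forest) : R := \prod_(t <- f) tree_weight t.

(** The probability that [j] independent Galton-Watson trees have [n] nodes in total. *)
Definition total_weight (j n : nat) : R :=
  \sum_(f <- forests j n) forest_weight f.

Lemma tree_weight_Node ts :
  tree_weight (Node ts) = p (size ts) * forest_weight ts.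
Proof. by rewrite /= big_map. Qed.

Lemma forest_weight_cons t f :
  forest_weight (t :: f) = tree_weight t * forest_weight f.
Proof. by rewrite /forest_weight big_cons. Qed.

Lemma forest_weight_grow d f : (d <= size f)%N ->
  forest_weight (grow d f) = p d * forest_weight f.
Proof.
move=> df; rewrite /grow forest_weight_cons tree_weight_Node size_takel //.
by rewrite -mulrA /forest_weight -big_cat cat_take_drop.
Qed.

Lemma tree_weight_ge0 t : 0 <= tree_weight t.
Proof.
elim/plane_tree_nested_ind: t => ts IH; rewrite tree_weight_Node mulr_ge0 //.
by rewrite /forest_weight big_seq; apply: prodr_ge0.
Qed.

Lemma forest_weight_ge0 f : 0 <= forest_weight f.
Proof. by apply: prodr_ge0 => t _; exact: tree_weight_ge0. Qed.

Lemma total_weight_ge0 j n : 0 <= total_weight j n.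
Proof. by apply: sumr_ge0 => f _; exact: forest_weight_ge0. Qed.

Lemma forest_weight_code f : forest_weight f = \prod_(d <- forest_code f) p d.
Proof.
move: {2}(fsize f) (leqnn (fsize f)) => n; elim: n f => [|n IH] [|[ts] f] //;
  rewrite ?/forest_weight ?big_nil //.
rewrite fsize_cons addSn ltnS /= -/(fsize ts) -fsize_cat => /IH fE.
rewrite forest_code_Node !big_cons tree_weight_Node -mulrA.
by rewrite -[in RHS]fE /forest_weight big_cat.
Qed.

Lemma tree_weight_code t : tree_weight t = \prod_(d <- tree_code t) p d.
Proof.
have := forest_weight_code [:: t].
by rewrite /forest_weight /forest_code big_seq1 /= cats0.
Qed.

Lemma sum_forestsSS j n (F : forest -> R) :
  \sum_(f <- forests j.+1 n.+1) F f =
  \sum_(d < n.+1) \sum_(f <- forests (j + d) n) F (grow d f).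
Proof.
rewrite -[forests j.+1 n.+1]/
  [seq grow d f | d <- iota 0 n.+1, f <- forests (j + d) n].
rewrite big_allpairs_dep -(big_mkord xpredT
  (fun d => \sum_(f <- forests (j + d) n) F (grow d f))).
by rewrite /index_iota subn0.
Qed.

Lemma forests_short j n : (n < j)%N -> forests j n = [::].
Proof.
move=> nj; case E: (forests j n) => [//|f s].
have : f \in forests j n by rewrite E mem_head.
rewrite mem_forests => /andP[/eqP fj /eqP fn].
by have := size_le_fsize f; rewrite fj fn leqNgt nj.
Qed.

Lemma total_weight_short j n : (n < j)%N -> total_weight j n = 0.
Proof. by move=> nj; rewrite /total_weight forests_short // big_nil. Qed.

Lemma total_weight0 n : total_weight 0 n = (n == 0%N)%:R.
Proof.
rewrite /total_weight; case: n => [|n] /=; last by rewrite big_nil.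
by rewrite big_seq1 /forest_weight big_nil.
Qed.

Lemma grow_weight j n d f : f \in forests (j + d) n ->
  forest_weight (grow d f) = p d * forest_weight f.
Proof.
rewrite mem_forests => /andP[/eqP sf _].
by rewrite forest_weight_grow // sf leq_addl.
Qed.

(** Terms with more roots than nodes vanish; the enlarged range makes the sums for
different numbers of nodes comparable term by term. *)
Lemma total_weightSS_wide N j n : (n < N)%N ->
  total_weight j.+1 n.+1 = \sum_(d < N) p d * total_weight (j + d) n.
Proof.
move=> nN; rewrite {1}/total_weight sum_forestsSS.
transitivity (\sum_(d < n.+1) p d * total_weight (j + d) n).
  by apply: eq_bigr => d _; rewrite big_distrr /=; apply: eq_big_seq => f;
     exact: grow_weight.
rewrite (big_ord_widen N (fun d => p d * total_weight (j + d) n)) // big_mkcond.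
apply: eq_bigr => d _; case: ltnP => // nd.
by rewrite total_weight_short ?mulr0 // (leq_trans nd) // leq_addl.
Qed.

Lemma total_weightSS j n :
  total_weight j.+1 n.+1 = \sum_(d < n.+1) p d * total_weight (j + d) n.
Proof. exact: total_weightSS_wide. Qed.

(** The total sizes of the first [i] and of the last [j] trees are independent. *)
Lemma total_weight_add i j n :
  total_weight (i + j) n =
  \sum_(m < n.+1) total_weight i m * total_weight j (n - m).
Proof.
elim: n i => [|n IH] [|i].
- by rewrite big_ord1 total_weight0 mul1r.
- rewrite big_ord1 addSn total_weight_short //.
  by rewrite [total_weight i.+1 _]total_weight_short // mul0r.
- rewrite big_ord_recl /= total_weight0 mul1r subn0 add0n big1 ?addr0 // => m _.
  by rewrite total_weight0 mul0r.
rewrite addSn total_weightSS [RHS]big_ord_recl /=.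
rewrite [total_weight i.+1 _]total_weight_short // mul0r add0r.
under eq_bigr => d _ do rewrite addnAC IH big_distrr /=.
rewrite exchange_big /=; apply: eq_bigr => m _.
rewrite /bump leq0n add1n subSS (@total_weightSS_wide n.+1) // big_distrl /=.
by apply: eq_bigr => d _; rewrite mulrA.
Qed.

Lemma total_weight_mul_le i j m n :
  total_weight i m * total_weight j n <= total_weight (i + j) (m + n).
Proof.
rewrite total_weight_add (bigD1 (inord m : 'I_(m + n).+1)) //=.
rewrite inordK ?ltnS ?leq_addr // addKn lerDl sumr_ge0 // => k _.
by rewrite mulr_ge0 ?total_weight_ge0.
Qed.

Lemma total_weight1_1 : total_weight 1 1 = p 0.
Proof. by rewrite total_weightSS big_ord1 total_weight0 mulr1. Qed.

Lemma p_le1 i : p i <= 1.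
Proof.
apply: le_trans (sum_p_le1 i.+1).
by rewrite big_ord_recr /= lerDr sumr_ge0.
Qed.

Lemma prod_p_le1 (s : seq nat) : \prod_(d <- s) p d <= 1.
Proof.
elim: s => [|d s IH]; rewrite ?big_nil // big_cons.
by rewrite mulr_ile1 // ?p_le1 // prodr_ge0.
Qed.

(** Replace the last leaf in preorder by a tree of [m.+1] nodes. That tree hangs on the
last branch, along which subtree sizes decrease strictly, so its size locates it and
nothing is counted twice; the leaf removed has weight at most 1. *)
Lemma total_weight_supermul n m :
  total_weight 1 n.+1 * total_weight 1 m.+1 <= total_weight 1 (n + m).+1.
Proof.
suff H k j : (0 < j)%N ->
    total_weight j k * total_weight 1 m.+1 <= total_weight j (k + m).
  by have := H n.+1 1%N isT; rewrite addSn.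
elim: k j => [|k IH] [|j] // _.
  by rewrite total_weight_short // mul0r total_weight_ge0.
case: (posnP (j + k)) => [/eqP|jk].
  rewrite addn_eq0 => /andP[/eqP -> /eqP ->].
  by rewrite total_weight1_1 ler_piMl ?total_weight_ge0 ?p_le1.
rewrite addSn !(@total_weightSS_wide (k + m).+1 j) ?ltnS ?leq_addr //.
rewrite big_distrl ler_sum //= => d _.
rewrite -mulrA ler_wpM2l //.
case: (posnP (j + d)) => [jd0|jd]; last by exact: IH.
rewrite jd0 total_weight0 (_ : k == 0%N = false) ?mul0r ?total_weight_ge0 //.
by apply/negbTE; rewrite -lt0n; move/eqP: jd0 jk; rewrite addn_eq0 => /andP[/eqP->].
Qed.

Lemma sum_total_weight_le1 j N : \sum_(n < N) total_weight j n <= 1.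
Proof.
elim: N j => [|N IH] j; first by rewrite big_ord0.
rewrite big_ord_recl /=; case: j => [|j].
  by rewrite total_weight0 big1 ?addr0 // => i _; rewrite total_weight0.
rewrite total_weight_short // add0r.
under eq_bigr => i _.
  rewrite /bump leq0n add1n (@total_weightSS_wide N) //.
  over.
rewrite exchange_big /=; apply: le_trans (sum_p_le1 N).
by apply: ler_sum => d _; rewrite -big_distrr /= ler_piMr.
Qed.

Lemma total_weight_le1 j n : total_weight j n <= 1.
Proof.
apply: le_trans (sum_total_weight_le1 j n.+1).
by rewrite big_ord_recr /= lerDr sumr_ge0 // => i _; exact: total_weight_ge0.
Qed.

Definition containing_weight (T : plane_tree) (j n : nat) : R :=
  \sum_(f <- forests j n | `[< fcontains f T >]) forest_weight f.

Lemma sum_forests_head T j n : (tree_size T <= n)%N ->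
  \sum_(f <- forests j.+1 n | ohead f == Some T) forest_weight f =
  tree_weight T * total_weight j (n - tree_size T).
Proof.
move=> Tn; rewrite -big_filter /total_weight big_distrr /=.
rewrite (perm_big (map (cons T) (forests j (n - tree_size T)))) /=.
  by rewrite big_map; apply: eq_bigr => f _; rewrite forest_weight_cons.
apply: uniq_perm; first exact/filter_uniq/forests_uniq.
  by rewrite map_inj_uniq ?forests_uniq // => f g [].
move=> f; rewrite mem_filter mem_forests; apply/idP/mapP.
  case: f => [|t f] //= /andP[/eqP[->]] /andP[/eqP[fj] /eqP fn].
  by exists f; rewrite // mem_forests fj -fn fsize_cons addKn !eqxx.
move=> [g]; rewrite mem_forests => /andP[/eqP gj /eqP gn] ->.
by rewrite /= gj fsize_cons gn subnKC // !eqxx.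
Qed.

(** Given its size, the first tree of a forest is distributed as a tree of that size. *)
Lemma sum_forests_head_le T j n :
  (\sum_(f <- forests j n | ohead f == Some T) forest_weight f)
    * total_weight 1 (tree_size T) <= tree_weight T * total_weight j n.
Proof.
have T0 := tree_weight_ge0 T; have := total_weight_ge0 j n => G0.
case: j => [|j] in G0 *.
  rewrite big_seq_cond big_pred0 ?mul0r ?mulr_ge0 // => f.
  by rewrite mem_forests; case: f => [|t f]; rewrite ?andbF.
have [Tn|nT] := leqP (tree_size T) n.
  rewrite sum_forests_head // -mulrA ler_wpM2l //.
  by apply: le_trans (total_weight_mul_le _ _ _ _) _; rewrite addn1 subnK.
rewrite big_seq_cond big_pred0 ?mul0r ?mulr_ge0 // => f.
apply/negbTE/negP; rewrite mem_forests; case: f => [//|t f].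
rewrite fsize_cons => /andP[/andP[_ /eqP fn] /eqP[tT]].
by move: nT; rewrite -fn -tT ltnNge leq_addr.
Qed.

(** Each node is the root of a copy of [T] with the probability that its subtree has
[tree_size T] nodes, times the conditional probability of [T]. Summing over the nodes
of the exploration gives the factor [n]. *)
Lemma containing_weight_le T j n :
  containing_weight T j n * total_weight 1 (tree_size T)
  <= n%:R * tree_weight T * total_weight j n.
Proof.
elim: n j => [|n IH] j.
  rewrite !mul0r /containing_weight big_seq_cond big_pred0 ?mul0r // => f.
  apply/negbTE/negP; rewrite mem_forests => /andP[/andP[_ /eqP f0]] /asboolP.
  by case: f f0 => [_ [t]//|[]].
case: j => [|j].
  by rewrite /containing_weight /total_weight /= !big_nil mul0r mulr0.
set a := total_weight 1 _.
apply: (@le_trans _ _ ((\sum_(d < n.+1) p d * containing_weight T (j + d) n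
   + \sum_(f <- forests j.+1 n.+1 | ohead f == Some T) forest_weight f) * a)).
  rewrite ler_wpM2r ?total_weight_ge0 //.
  rewrite /containing_weight [leLHS]big_mkcond sum_forestsSS.
  rewrite [X in _ <= _ + X]big_mkcond sum_forestsSS -big_split /=.
  apply: ler_sum => d _; rewrite big_distrr /= [X in X + _]big_mkcond.
  rewrite -big_split /= !big_seq; apply: ler_sum => f fin.
  have -> := grow_weight fin.
  have ge0 : 0 <= p d * forest_weight f by rewrite mulr_ge0 ?forest_weight_ge0.
  case: asboolP => [/fcontains_grow[H|H]|_]; last 1 first.
  - by apply: addr_ge0; case: ifP.
  - by rewrite /= H eqxx lerDr; case: ifP.
  - by rewrite (_ : `[< _ >]); [rewrite lerDl; case: ifP|apply/asboolP].
rewrite mulrDl -natr1 2!mulrDl mul1r lerD ?sum_forests_head_le //.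
rewrite total_weightSS big_distrl big_distrr /= ler_sum // => d _.
by rewrite -mulrA [leRHS]mulrCA ler_wpM2l.
Qed.

Definition avoiding_weight (T : plane_tree) (j n : nat) : R :=
  \sum_(f <- forests j n | ~~ `[< fcontains f T >]) forest_weight f.

Lemma sum_grow_avoiding_le T (B : pred forest) j n d :
  \sum_(f <- forests (j + d) n | ~~ `[< fcontains (grow d f) T >] && B (grow d f))
     forest_weight (grow d f) <=
  p d * \sum_(f <- forests (j + d) n | ~~ `[< fcontains f T >] && B (grow d f))
     forest_weight f.
Proof.
rewrite big_distrr /= ![leLHS]big_mkcond ![leRHS]big_mkcond /= !big_seq.
apply: ler_sum => f fin; rewrite (grow_weight fin).
have ge0 : 0 <= p d * forest_weight f by rewrite mulr_ge0 ?forest_weight_ge0.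
case: (asboolP (fcontains f T)) => [fT|_] /=; last first.
  by case: ifP => [/andP[_ ->]//|]; case: ifP.
by rewrite (_ : `[< _ >]) //; apply/asboolP/fcontains_grow; right.
Qed.

Lemma avoiding_weight_bound_add T (M : R) n r : 0 <= M ->
  (forall j, avoiding_weight T j n <= M) ->
  forall j, avoiding_weight T j (r + n) <= M.
Proof.
move=> M0 nM; elim: r => [//|r IH] [|j].
  by rewrite /avoiding_weight big_nil.
rewrite addSn /avoiding_weight big_mkcond sum_forestsSS.
apply: (@le_trans _ _ (\sum_(d < (r + n).+1) p d * M)).
  apply: ler_sum => d _; rewrite -big_mkcond /=.
  have := @sum_grow_avoiding_le T xpredT j (r + n) d => /=.
  under eq_bigl do rewrite andbT.
  under [X in _ * X]eq_bigl do rewrite andbT.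
  by move=> /le_trans; apply; rewrite ler_wpM2l // IH.
by rewrite -big_distrl /= ler_piMl // sum_p_le1.
Qed.

(** Expose the preorder degrees one at a time. As long as they follow [c], the next one
may leave [c]; whatever remains afterwards still avoids [T], and is bounded by [M].
The code follows [c] entirely with probability [\prod_(d <- c) p d]. *)
Lemma avoiding_prefix_le T (M : R) n c : 0 <= M ->
  (forall j, avoiding_weight T j n <= M) ->
  forall j, \sum_(f <- forests j (size c + n) |
      ~~ `[< fcontains f T >] && ~~ prefix c (forest_code f)) forest_weight f
    <= (1 - \prod_(d <- c) p d) * M.
Proof.
move=> M0 nM; elim: c => [|e c IH] j.
  rewrite [\prod_(d <- _) _]big_nil subrr mul0r big_pred0 // => f.
  by rewrite prefix0s andbF.
have pc1 : \prod_(d <- e :: c) p d <= 1.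
  exact: prod_p_le1.
case: j => [|j]; first by rewrite big_nil mulr_ge0 // subr_ge0.
rewrite [size _]/= addSn big_mkcond sum_forestsSS big_cons.
set N := (size c + n)%N; set q := \prod_(d <- c) p d in IH *.
pose B (f : forest) := ~~ prefix (e :: c) (forest_code f).
pose S d := \sum_(f <- forests (j + d) N |
  ~~ `[< fcontains (grow d f) T >] && B (grow d f)) forest_weight (grow d f).
have S_ge0 d : 0 <= S d by apply: sumr_ge0 => f _; exact: forest_weight_ge0.
have S_le d : S d <= p d * (M - (d == e)%:R * (q * M)).
  apply: le_trans (sum_grow_avoiding_le _ _ _ _ _) _; rewrite ler_wpM2l //.
  have [->|de] := eqVneq d e.
    rewrite mul1r (_ : M - q * M = (1 - q) * M); last by rewrite mulrBl mul1r.
    apply: le_trans (IH (j + e)%N).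
    rewrite big_seq_cond [leRHS]big_seq_cond le_eqVlt; apply/orP; left; apply/eqP.
    apply: eq_bigl => f; case fin : (f \in _) => //=.
    move: fin; rewrite mem_forests => /andP[/eqP sf _].
    by rewrite /B forest_code_grow ?sf ?leq_addl //= eqxx.
  rewrite mul0r subr0; apply: le_trans (avoiding_weight_bound_add (size c) M0 nM (j + d)).
  rewrite /avoiding_weight big_mkcond [leRHS]big_mkcond; apply: ler_sum => f _.
  by case: asboolP => //= _; case: ifP => // _; exact: forest_weight_ge0.
have -> : \sum_(d < N.+1) \sum_(f <- forests (j + d) N)
    (if ~~ `[< fcontains (grow d f) T >] && ~~ prefix (e :: c) (forest_code (grow d f))
     then forest_weight (grow d f) else 0) = \sum_(d < N.+1) S d.
  by apply: eq_bigr => d _; rewrite -big_mkcond.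
(* The range of d is enlarged so that it contains e, also when e exceeds N. *)
apply: (@le_trans _ _ (\sum_(d < (maxn N e).+1) S d)).
  rewrite (big_ord_widen (maxn N e).+1 S) ?ltnS ?leq_maxl // big_mkcond.
  by apply: ler_sum => d _; case: ifP.
apply: le_trans (ler_sum _ (fun d _ => S_le (nat_of_ord d))) _.
under eq_bigr => d _ do rewrite mulrBr.
rewrite sumrB -big_distrl /= [X in _ - X](bigD1 (inord e : 'I_(maxn N e).+1)) //=.
rewrite inordK ?ltnS ?leq_maxr // eqxx mul1r.
rewrite [X in _ - (_ + X)]big1 => [|d /negbTE de]; rewrite ?addr0.
  by rewrite [leRHS]mulrBl mul1r -mulrA lerD2r ler_piMl // sum_p_le1.
rewrite (_ : (d == e :> nat) = false) ?mul0r ?mulr0 //.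
apply/negP => /eqP E; move/eqP: de; apply; apply/val_inj.
by rewrite /= inordK ?ltnS ?leq_maxr.
Qed.

(** Cut the preorder degree sequence into blocks of length [tree_size T]: a block that
equals the code of [T] exhibits [T] as a fringe subtree. *)
Lemma avoiding_weight_le T j n :
  avoiding_weight T j n <= (1 - tree_weight T) ^+ (n %/ tree_size T).
Proof.
have w1 : tree_weight T <= 1.
  by rewrite tree_weight_code prod_p_le1.
have q0 : 0 <= 1 - tree_weight T by rewrite subr_ge0.
suff H m : forall j, avoiding_weight T j (m * tree_size T) <= (1 - tree_weight T) ^+ m.
  rewrite {1}(divn_eq n (tree_size T)) addnC.
  by apply: avoiding_weight_bound_add => //; exact: exprn_ge0.
elim: m => [|m IH] {}j.
  rewrite mul0n expr0; apply: le_trans (total_weight_le1 j 0).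
  rewrite /avoiding_weight big_mkcond; apply: ler_sum => f _.
  by case: ifP => // _; exact: forest_weight_ge0.
case: j => [|j].
  rewrite /avoiding_weight mulSn; case: (tree_size T) (tree_size_gt0 T) => // s _.
  by rewrite big_nil exprn_ge0.
have := avoiding_prefix_le (tree_code T) (exprn_ge0 m q0) IH j.+1.
rewrite size_tree_code -mulSn -tree_weight_code -exprS.
apply: le_trans; rewrite /avoiding_weight big_seq_cond [leRHS]big_seq_cond.
rewrite le_eqVlt; apply/orP; left; apply/eqP; apply: eq_bigl => f.
case fin : (f \in _) => //=; move: fin; rewrite mem_forests => /andP[/eqP sf _].
case: asboolP => //= fT; apply/esym/negP => /prefixP[r fr]; apply: fT.
have [|f' ->] := forest_code_head _ fr; first by rewrite sf.
by exists T; rewrite ?mem_head //; exact: contains_fringe_refl.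
Qed.

End Weights.

(** * Elementary identities and inequalities *)

Lemma triangle_sum (R : nmodType) (F : nat -> nat -> R) N :
  \sum_(n < N) \sum_(m < n.+1) F m (n - m)%N =
  \sum_(m < N) \sum_(l < N - m) F m l.
Proof.
elim: N => [|N IH]; first by rewrite !big_ord0.
rewrite [LHS]big_ord_recr [RHS]big_ord_recr /= IH subSnn big_ord1.
rewrite [X in _ + X = _]big_ord_recr /= subnn addrA; congr (_ + _).
rewrite -big_split /=; apply: eq_bigr => m _.
by rewrite subSn ?(ltnW (ltn_ord m)) // big_ord_recr.
Qed.

Section PowerBounds.
Variable R : realFieldType.

Lemma expr_1B_le (u : R) i : 0 <= u <= 1 ->
  (1 - u) ^+ i <= 1 - i%:R * u + i%:R ^+ 2 * u ^+ 2.
Proof.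
move=> /andP[u0 u1]; elim: i => [|i IH]; first by rewrite expr0; lra.
rewrite exprSr.
have : (1 - u) ^+ i * (1 - u) <= (1 - i%:R * u + i%:R ^+ 2 * u ^+ 2) * (1 - u).
  by rewrite ler_wpM2r // subr_ge0.
have i0 : 0 <= i%:R :> R by [].
have : 0 <= i%:R ^+ 2 * u ^+ 3 by rewrite mulr_ge0 // exprn_ge0.
have : 0 <= i%:R * u ^+ 2 by rewrite mulr_ge0 // exprn_ge0.
have : 0 <= u ^+ 2 by rewrite exprn_ge0.
rewrite -natr1; nra.
Qed.

Lemma expr_1B_ge (u : R) i : 0 <= u <= 1 ->
  1 - i%:R * u + (2 <= i)%N%:R * u ^+ 2 <= (1 - u) ^+ i.
Proof.
move=> /andP[u0 u1]; elim: i => [|i IH]; first by rewrite expr0 /=; lra.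
rewrite exprSr.
have : 0 <= (1 - u) ^+ i <= 1 by rewrite exprn_ge0 ?exprn_ile1; lra.
case: i IH => [|[|i]] /=; rewrite ?expr0 ?expr1 ?mulr0n ?mulr1n //=.
- by move=> _ _; rewrite mul0r; lra.
- by move=> _ _; rewrite expr2; lra.
move=> IH /andP[E0 E1].
have : (1 - u) ^+ i.+2 * u <= (1 - u) ^+ 1 * u.
  by rewrite ler_wpM2r // ler_wiXn2l //; lra.
rewrite expr1 => Eu; have uu := sqr_ge0 u; rewrite expr2 in uu.
have -> : i.+3%:R = i.+2%:R + 1 :> R by rewrite natr1.
move: IH E0 E1 Eu; set E := (1 - u) ^+ i.+2; set m := i.+2%:R.
move=> IH E0 E1 Eu; rewrite [leRHS]exprSr -/E; rewrite expr2 in IH; lra.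
Qed.

Lemma bernoulli_inv (n M : nat) : (0 < M)%N ->
  (1 - M%:R^-1 : R) ^+ n <= (1 + n%:R / M%:R)^-1.
Proof.
move=> M0; have m0 : 0 < (M%:R^-1 : R) by rewrite invr_gt0 ltr0n.
have m1 : (M%:R^-1 : R) <= 1 by rewrite invf_le1 ?ltr0n // ler1n.
rewrite -[leRHS]mul1r ler_pdivlMr; last by have : 0 <= n%:R / M%:R :> R by []; lra.
elim: n => [|n IH]; first by rewrite expr0; lra.
apply: le_trans IH; rewrite exprSr -mulrA ler_wpM2l ?exprn_ge0 ?subr_ge0 //.
rewrite -natr1 mulrDl mul1r; have : 0 <= n%:R / M%:R :> R by [].
nra.
Qed.

End PowerBounds.

Lemma leq_divn_mul2 n l : (0 < l)%N -> (2 * l <= n)%N -> (n <= n %/ l * (2 * l))%N.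
Proof.
by move=> l0 ln; have := ltn_ceil n l0; rewrite mulSn mulnCA; lia.
Qed.

Lemma ln_le_powR (R : realType) (x eps : R) : 0 < eps -> 0 < x ->
  ln x <= eps^-1 * x `^ eps.
Proof.
move=> e0 x0; rewrite ler_pdivlMl // -ln_powR; apply/ltW/ln_sublinear.
exact: powR_gt0.
Qed.

(** * The generating function of the tree size *)

(** The properties of the offspring law that the analysis uses, as statements on partial
sums so that they can be combined with the finite sums over forests. *)
Record critical_law (R : realType) (p : nat -> R) : Prop := CriticalLaw {
  critical_ge0 : forall i, 0 <= p i;
  critical_mass : (fun N => \sum_(i < N) p i) @ \oo --> (1 : R);
  critical_mean : (fun N => \sum_(i < N) i%:R * p i) @ \oo --> (1 : R);
  critical_second : exists2 K, 0 < K & forall N, \sum_(i < N) i%:R ^+ 2 * p i <= K;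
  critical_zero : 0 < p 0%N;
  critical_branching : exists2 b, (2 <= b)%N & 0 < p b
}.

Section GeneratingFunction.
Variables (R : realType) (p : nat -> R).
Hypothesis critp : critical_law p.

Let p_ge0 := critical_ge0 critp.

Lemma partial_sum_le_lim (u : nat -> R) l : (forall i, 0 <= u i) ->
  (fun N => \sum_(i < N) u i) @ \oo --> l -> forall N, \sum_(i < N) u i <= l.
Proof.
move=> u0 ul N; have <- := cvg_lim (@Rhausdorff R) ul.
apply: (@nondecreasing_cvgn_le R (fun N => \sum_(i < N) u i)).
  apply/nondecreasing_seqP => n; by rewrite big_ord_recr /= lerDl.
by apply/cvg_ex; exists l.
Qed.

Lemma critical_mass_le1 N : \sum_(i < N) p i <= 1.
Proof. exact: (partial_sum_le_lim p_ge0 (critical_mass critp)). Qed.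

Lemma critical_mean_le1 N : \sum_(i < N) i%:R * p i <= 1.
Proof.
have m0 i : 0 <= i%:R * p i by rewrite mulr_ge0.
exact: (partial_sum_le_lim m0 (critical_mean critp)).
Qed.

Let mass_le1 := critical_mass_le1.
Local Notation G := (total_weight p).
Local Notation a := (total_weight p 1).

Let G_ge0 j n : 0 <= G j n. Proof. exact: total_weight_ge0. Qed.

(** The generating function of the total size of [j] trees, truncated at [N]. *)
Definition partial_gf (s : R) (j N : nat) : R := \sum_(n < N) G j n * s ^+ n.

Lemma partial_gf_ge0 s j N : 0 <= s -> 0 <= partial_gf s j N.
Proof. by move=> s0; apply: sumr_ge0 => n _; rewrite mulr_ge0 ?exprn_ge0. Qed.

Lemma partial_gf_le s j M N : 0 <= s -> (M <= N)%N ->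
  partial_gf s j M <= partial_gf s j N.
Proof.
move=> s0 MN; rewrite /partial_gf (big_ord_widen N (fun n => G j n * s ^+ n)) //.
rewrite big_mkcond; apply: ler_sum => n _.
by case: ifP => // _; rewrite mulr_ge0 ?exprn_ge0.
Qed.

Lemma partial_gf_add s i j N : 
  partial_gf s (i + j) N =
  \sum_(m < N) \sum_(l < N - m) (G i m * s ^+ m) * (G j l * s ^+ l).
Proof.
rewrite -(triangle_sum (fun m l => (G i m * s ^+ m) * (G j l * s ^+ l))).
apply: eq_bigr => n _.
rewrite total_weight_add // big_distrl /=; apply: eq_bigr => m _.
rewrite mulrACA -exprD subnKC //; by rewrite -ltnS.
Qed.

Lemma partial_gf_add_le s i j N : 0 <= s ->
  partial_gf s (i + j) N <= partial_gf s i N * partial_gf s j N.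
Proof.
move=> s0; rewrite partial_gf_add {2}/partial_gf big_distrl /=; apply: ler_sum => m _.
rewrite -big_distrr /= ler_wpM2l ?mulr_ge0 ?exprn_ge0 //.
by apply: (@partial_gf_le s j) => //; exact: leq_subr.
Qed.

Lemma partial_gf_add_ge s i j N M : 0 <= s ->
  partial_gf s i N * partial_gf s j M <= partial_gf s (i + j) (N + M).
Proof.
move=> s0; rewrite partial_gf_add {1}/partial_gf.
rewrite (big_ord_widen (N + M) (fun n => G i n * s ^+ n)) ?leq_addr //.
rewrite big_distrl /= big_mkcond; apply: ler_sum => m _.
case: ltnP => [mN|_]; last first.
  apply: sumr_ge0 => l _; by rewrite !mulr_ge0 ?exprn_ge0.
rewrite -big_distrr /= ler_wpM2l ?mulr_ge0 ?exprn_ge0 //.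
by apply: (@partial_gf_le s j) => //; rewrite -{1}(addKn m M) leq_sub2r // leq_add2r ltnW.
Qed.

Lemma partial_gf0 s N : partial_gf s 0 N = (0 < N)%N%:R.
Proof.
rewrite /partial_gf; case: N => [|N]; first by rewrite big_ord0.
rewrite big_ord_recl /= total_weight0 mul1r expr0 big1 ?addr0 // => i _.
by rewrite total_weight0 mul0r.
Qed.

Lemma partial_gf_le_exp s j N : 0 <= s ->
  partial_gf s j N <= partial_gf s 1 N ^+ j.
Proof.
move=> s0; elim: j => [|j IH]; first by rewrite partial_gf0 expr0; case: ltnP.
rewrite -(add1n j) exprD expr1; apply: le_trans (partial_gf_add_le _ _ _ s0) _.
by rewrite ler_wpM2l ?partial_gf_ge0.
Qed.

Lemma exp_le_partial_gf s j N : 0 <= s ->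
  partial_gf s 1 N ^+ j <= partial_gf s j (j * N).+1.
Proof.
move=> s0; elim: j => [|j IH]; first by rewrite partial_gf0 expr0.
rewrite -(add1n j) exprD expr1 mulnDl mul1n -addnS.
by apply: le_trans (partial_gf_add_ge _ _ _ _ s0); rewrite ler_wpM2l ?partial_gf_ge0.
Qed.

Lemma partial_gfS s N :
  partial_gf s 1 N.+1 = s * \sum_(d < N) p d * partial_gf s d N.
Proof.
rewrite {1}/partial_gf big_ord_recl total_weight_short // mul0r add0r.
under eq_bigr => n _ do rewrite /= /bump leq0n add1n
  (@total_weightSS_wide R p N) // exprS mulrCA big_distrl.
rewrite -big_distrr /= exchange_big /=; congr (_ * _); apply: eq_bigr => d _.
by rewrite big_distrr /=; apply: eq_bigr => n _; rewrite mulrA.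
Qed.

Lemma partial_gf_le1 s N : 0 <= s <= 1 -> partial_gf s 1 N <= 1.
Proof.
move=> /andP[s0 s1]; apply: le_trans (sum_total_weight_le1 p_ge0 mass_le1 1 N).
by apply: ler_sum => n _; rewrite ler_piMr // exprn_ile1.
Qed.

Definition gf (s : R) : R := limn (partial_gf s 1).

Lemma partial_gf_cvg s : 0 <= s <= 1 -> partial_gf s 1 @ \oo --> gf s.
Proof.
move=> /andP[s0 s1]; apply: nondecreasing_is_cvgn.
  by move=> m n mn; exact: partial_gf_le.
by exists 1 => _ [N _ <-]; apply: partial_gf_le1; rewrite s0.
Qed.

Lemma partial_gf_le_gf s N : 0 <= s <= 1 -> partial_gf s 1 N <= gf s.
Proof.
move=> s01; apply: nondecreasing_cvgn_le.
  by case/andP: s01 => s0 _ m n mn; exact: partial_gf_le.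
exact: (cvgP _ (partial_gf_cvg s01)).
Qed.

Lemma gf_le s l : 0 <= s <= 1 -> (forall N, partial_gf s 1 N <= l) -> gf s <= l.
Proof.
move=> s01 H; apply: limr_le; first exact: (cvgP _ (partial_gf_cvg s01)).
by near=> n; exact: H.
Unshelve. all: by end_near. Qed.

Lemma gf_bounds s : 0 <= s <= 1 -> 0 <= gf s <= 1.
Proof.
move=> s01; rewrite gf_le // => [|N]; last exact: partial_gf_le1.
rewrite andbT; apply: le_trans (partial_gf_le_gf 0 s01).
by rewrite /partial_gf big_ord0.
Qed.

(** The upper half of [y = s f(y)], where [f (1 - u) <= 1 - u + K u ^ 2] because the mean
is 1 and the second moment is at most [K]. *)
Lemma gf_le_quadratic K s : 0 <= s <= 1 ->
  (forall N, \sum_(i < N) i%:R ^+ 2 * p i <= K) ->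
  gf s <= s * (gf s + K * (1 - gf s) ^+ 2).
Proof.
move=> s01 hK; have /andP[s0 s1] := s01.
have Acvg := partial_gf_cvg s01.
pose A := partial_gf s 1; pose mu N := \sum_(i < N) i%:R * p i.
have step N : A N.+1 <= s * (1 - (1 - A N) * mu N + K * (1 - A N) ^+ 2).
  have A0 : 0 <= A N by exact: partial_gf_ge0.
  have A1 : A N <= 1 by exact: partial_gf_le1.
  have u01 : 0 <= 1 - A N <= 1 by apply/andP; split; lra.
  rewrite /A partial_gfS ler_wpM2l //.
  apply: (@le_trans _ _ (\sum_(d < N) p d *
     (1 - d%:R * (1 - A N) + d%:R ^+ 2 * (1 - A N) ^+ 2))).
    apply: ler_sum => d _; rewrite ler_wpM2l //.
    apply: le_trans (partial_gf_le_exp _ _ s0) _.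
    by rewrite -[partial_gf s 1 N](subKr 1) expr_1B_le.
  have -> : \sum_(d < N) p d *
     (1 - d%:R * (1 - A N) + d%:R ^+ 2 * (1 - A N) ^+ 2) =
     \sum_(d < N) p d - (1 - A N) * mu N +
     (\sum_(d < N) d%:R ^+ 2 * p d) * (1 - A N) ^+ 2.
    rewrite /mu big_distrr big_distrl /= -sumrB -big_split /=.
    by apply: eq_bigr => d _; ring.
  by rewrite lerD ?lerD2r ?mass_le1 // ler_wpM2r ?sqr_ge0.
have L : (fun N => A N.+1) @ \oo --> gf s by rewrite cvg_shiftS.
have -> : s * (gf s + K * (1 - gf s) ^+ 2) =
   s * (1 - (1 - gf s) * 1 + K * (1 - gf s) ^+ 2) by ring.
apply: ler_cvg_to L _ _; last by near=> n; exact: step.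
have B : (1 - A n) @[n --> \oo] --> 1 - gf s by apply: cvgB => //; exact: cvg_cst.
apply: cvgM; first exact: cvg_cst.
apply: cvgD; first apply: cvgB; first exact: cvg_cst.
  by apply: cvgM => //; exact: (critical_mean critp).
apply: cvgM; first exact: cvg_cst.
by under eq_fun do rewrite expr2; rewrite expr2; exact: cvgM.
Unshelve. all: by end_near. Qed.

(** The lower half of [y = s f(y)], where [f (1 - u) >= 1 - u + p b * u ^ 2] because the
mean is 1 and degrees [b >= 2] contribute a quadratic term. *)
Lemma quadratic_le_gf b s : (2 <= b)%N -> 0 <= s <= 1 ->
  s * (gf s + p b * (1 - gf s) ^+ 2) <= gf s.
Proof.
move=> b2 s01; have /andP[s0 s1] := s01.
have Acvg := partial_gf_cvg s01.
pose A := partial_gf s 1; pose m N := \sum_(i < N) p i.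
have step N : (b < N)%N -> s * (m N - (1 - A N) + p b * (1 - A N) ^+ 2) <= gf s.
  move=> bN; have A0 : 0 <= A N by exact: partial_gf_ge0.
  have A1 : A N <= 1 by exact: partial_gf_le1.
  have u01 : 0 <= 1 - A N <= 1 by apply/andP; split; lra.
  pose M := (N + N * N).+1.
  apply: le_trans (partial_gf_le_gf M.+1 s01).
  rewrite partial_gfS ler_wpM2l //.
  apply: (@le_trans _ _ (\sum_(d < N) p d * A N ^+ d)); last first.
    rewrite (big_ord_widen M (fun d => p d * A N ^+ d)); last first.
      by rewrite /M ltnW // ltnS leq_addr.
    rewrite big_mkcond; apply: ler_sum => d _; case: ltnP => dN.
      rewrite ler_wpM2l //; apply: le_trans (exp_le_partial_gf _ _ s0) _.
      apply: partial_gf_le => //; rewrite ltnS.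
      by apply: (leq_trans (leq_mul (ltnW dN) (leqnn N))); rewrite leq_addl.
    by rewrite mulr_ge0 ?partial_gf_ge0.
  apply: (@le_trans _ _ (\sum_(d < N) p d *
     (1 - d%:R * (1 - A N) + (2 <= d)%N%:R * (1 - A N) ^+ 2))); last first.
    apply: ler_sum => d _; rewrite ler_wpM2l //.
    by rewrite -[X in _ <= X ^+ _](subKr 1) expr_1B_ge.
  have -> : \sum_(d < N) p d *
     (1 - d%:R * (1 - A N) + (2 <= d)%N%:R * (1 - A N) ^+ 2) =
     m N - (1 - A N) * (\sum_(d < N) d%:R * p d) +
     (\sum_(d < N) (2 <= d)%N%:R * p d) * (1 - A N) ^+ 2.
    rewrite /m big_distrr big_distrl /= -sumrB -big_split /=.
    by apply: eq_bigr => d _; ring.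
  apply: lerD.
    by rewrite lerD2l lerN2 ler_piMr ?critical_mean_le1 // subr_ge0.
  rewrite ler_wpM2r ?sqr_ge0 // (bigD1 (Ordinal bN)) //= b2 mul1r lerDl.
  by apply: sumr_ge0 => d _; rewrite mulr_ge0.
have -> : s * (gf s + p b * (1 - gf s) ^+ 2) =
   s * (1 - (1 - gf s) + p b * (1 - gf s) ^+ 2) by ring.
have B : (1 - A n) @[n --> \oo] --> 1 - gf s by apply: cvgB => //; exact: cvg_cst.
have L : (fun N => s * (m N - (1 - A N) + p b * (1 - A N) ^+ 2)) @ \oo -->
    s * (1 - (1 - gf s) + p b * (1 - gf s) ^+ 2).
  apply: cvgM; first exact: cvg_cst.
  apply: cvgD; first by apply: cvgB => //; exact: (critical_mass critp).
  apply: cvgM; first exact: cvg_cst.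
  by under eq_fun do rewrite expr2; rewrite expr2; exact: cvgM.
rewrite -(cvg_lim (@Rhausdorff R) L); apply: limr_le; first exact: (cvgP _ L).
by near=> n; apply: step; near: n; exact: nbhs_infty_gt.
Unshelve. all: by end_near. Qed.

End GeneratingFunction.

Section SizeDistribution.
Variables (R : realType) (p : nat -> R).
Hypothesis critp : critical_law p.

Let p_ge0 := critical_ge0 critp.
Let mass_le1 := critical_mass_le1 critp.
Local Notation a := (total_weight p 1).
Let a_ge0 n : 0 <= a n. Proof. exact: total_weight_ge0. Qed.

(** One minus the probability that the tree is finite and has no killed node, when each
node is killed independently with probability [1 / M]. *)
Definition gf_gap (M : nat) : R := 1 - gf p (1 - M%:R^-1).

Lemma invn_itv (M : nat) : (0 < M)%N -> 0 <= (1 - M%:R^-1 : R) <= 1.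
Proof.
move=> M0; have m0 : 0 < (M%:R^-1 : R) by rewrite invr_gt0 ltr0n.
have m1 : (M%:R^-1 : R) <= 1 by rewrite invf_le1 ?ltr0n // ler1n.
by apply/andP; split; lra.
Qed.

Lemma gf_gap_bounds M : (0 < M)%N -> 0 <= gf_gap M <= 1.
Proof.
move=> M0; have /andP[y0 y1] := gf_bounds critp (invn_itv M0).
by rewrite /gf_gap; apply/andP; split; lra.
Qed.

Lemma gf_gap_sqr_le b M : (2 <= b)%N -> 0 < p b -> (1 < M)%N ->
  gf_gap M ^+ 2 <= 2 / (p b * M%:R).
Proof.
move=> b2 pb M1; have M0 := ltnW M1.
have m0 : 0 < (M%:R^-1 : R) by rewrite invr_gt0 ltr0n.
have m2 : (M%:R^-1 : R) <= 2^-1 by rewrite lef_pV2 ?posrE ?ltr0n // ler_nat.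
have /andP[y0 y1] := gf_bounds critp (invn_itv M0).
have := quadratic_le_gf critp b2 (invn_itv M0).
rewrite /gf_gap; set y := gf p _; set m := M%:R^-1.
have u0 : 0 <= p b * (1 - y) ^+ 2 by rewrite mulr_ge0 ?sqr_ge0 // ltW.
move=> H; rewrite ler_pdivlMr ?mulr_gt0 ?ltr0n // mulrA [_ * p b]mulrC.
rewrite -ler_pdivlMr ?ltr0n // -/m.
rewrite -/m in m0 m2; move: u0 H; set u := p b * _ => u0 H.
have h1 : m * u <= 2^-1 * u by rewrite ler_wpM2r.
have h2 : m * y <= m * 1 by rewrite ler_wpM2l // ltW.
lra.
Qed.

Lemma gf_gap_sqr_ge K M : (forall N, \sum_(i < N) i%:R ^+ 2 * p i <= K) -> 0 < K ->
  (0 < M)%N -> gf_gap M <= 2^-1 -> (2 * K * M%:R)^-1 <= gf_gap M ^+ 2.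
Proof.
move=> hK K0 M0 gap.
have m0 : 0 < (M%:R^-1 : R) by rewrite invr_gt0 ltr0n.
have /andP[s0 s1] := invn_itv M0.
have := gf_le_quadratic critp (invn_itv M0) hK.
move: gap; rewrite /gf_gap; set y := gf p _ => gap H.
have u0 : 0 <= K * (1 - y) ^+ 2 by rewrite mulr_ge0 ?sqr_ge0 // ltW.
rewrite (_ : 2 * K * M%:R = K * (2 * M%:R)); last by ring.
rewrite invfM ler_pdivrMl // invfM.
move: u0 H; set u := K * _ => u0; set m := M%:R^-1 in m0 s0 s1 * => H.
have h1 : 0 <= m * u by rewrite mulr_ge0 // ltW.
have h2 : m * 2^-1 <= m * y by rewrite ler_wpM2l; lra.
lra.
Qed.

(** A tree of [L] nodes or more contains a killed node with probability at least 1/2. *)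
Lemma tail_le_gf_gap L : (0 < L)%N -> 1 - \sum_(n < L) a n <= 2 * gf_gap L.
Proof.
move=> L0; have /andP[s0 s1] := invn_itv L0.
set T := \sum_(n < L) a n; rewrite /gf_gap; set s := 1 - L%:R^-1 in s0 s1 *.
have T1 : T <= 1 by exact: sum_total_weight_le1.
have sL : s ^+ L <= 2^-1.
  have := bernoulli_inv R L L0; rewrite divff ?pnatr_eq0 -?lt0n //.
suff : gf p s <= T + s ^+ L * (1 - T) by nra.
apply: gf_le => //; first by rewrite s0.
move=> N; apply: le_trans (partial_gf_le critp 1 s0 (leq_addl L N)) _.
rewrite /partial_gf big_split_ord /= lerD //.
  by apply: ler_sum => n _; rewrite ler_piMr // exprn_ile1.
have : \sum_(n < L + N) a n <= 1 by exact: sum_total_weight_le1.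
rewrite big_split_ord /= -/T => TN.
apply: (@le_trans _ _ (s ^+ L * \sum_(i < N) a (L + i))).
  rewrite big_distrr /=; apply: ler_sum => n _.
  by rewrite mulrC exprD -mulrA ler_wpM2l ?exprn_ge0 // ler_piMl // exprn_ile1.
by rewrite ler_wpM2l ?exprn_ge0 //; lra.
Qed.

(** The left-hand side only counts the killed trees of fewer than [M] nodes. *)
Lemma head_le_gf_gap M : (0 < M)%N ->
  \sum_(n < M) a n * (1 - (1 - M%:R^-1) ^+ n) <= gf_gap M.
Proof.
move=> M0; have /andP[s0 s1] := invn_itv M0.
rewrite /gf_gap; set s := 1 - M%:R^-1 in s0 s1 *.
rewrite lerBrDl -lerBrDr; apply: gf_le => //; first by rewrite s0.
move=> N; apply: le_trans (partial_gf_le critp 1 s0 (leq_addl M N)) _.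
rewrite lerBrDr /partial_gf big_split_ord /= addrAC -big_split /=.
apply: le_trans (sum_total_weight_le1 p_ge0 mass_le1 1 (M + N)).
rewrite big_split_ord /= lerD //.
  by apply: ler_sum => n _; rewrite mulrBr mulr1 addrC subrK.
by apply: ler_sum => n _; rewrite ler_piMr // exprn_ile1.
Qed.

(** Split the trees that contain a killed node at rate [1 / N] by their size. The large
ones are bounded by the tail. For a small one, of [n < M] nodes, the probability of a
killed node is at most [n / N], that is at most [2 M / N] times its value at rate
[1 / M]. *)
Lemma gf_gap_le_window M N L : (0 < M <= L)%N -> (0 < N)%N ->
  gf_gap N <= 2 * gf_gap L + 2 * M%:R / N%:R * gf_gap M +
    \sum_(M <= n < L) a n.
Proof.
move=> /andP[M0 ML] N0; have /andP[s0 s1] := invn_itv N0.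
have L0 := leq_trans M0 ML.
have yge : partial_gf p (1 - N%:R^-1) 1 L <= gf p (1 - N%:R^-1).
  by apply: partial_gf_le_gf => //; rewrite s0.
have tail := tail_le_gf_gap L0; have head := head_le_gf_gap M0.
have n0 : 0 < (N%:R : R) by rewrite ltr0n.
have m0 : 0 < (M%:R : R) by rewrite ltr0n.
have : \sum_(n < M) a n * (1 - (1 - N%:R^-1) ^+ n) <= 2 * M%:R / N%:R * gf_gap M.
  apply: (@le_trans _ _ (2 * M%:R / N%:R *
      \sum_(n < M) a n * (1 - (1 - M%:R^-1) ^+ n))); last first.
    by rewrite ler_wpM2l //.
  rewrite big_distrr /=; apply: ler_sum => n _; rewrite mulrCA ler_wpM2l //.
  have iN : 0 <= (N%:R^-1 : R) <= 1 by apply/andP; split; lra.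
  have h1 := expr_1B_ge n iN; have h2 := bernoulli_inv R n M0.
  have h3 : 0 <= (2 <= n)%N%:R * (N%:R^-1 : R) ^+ 2 by rewrite mulr_ge0 ?sqr_ge0.
  apply: (@le_trans _ _ (n%:R / N%:R)); first by lra.
  rewrite [2 * _ / _]mulrAC -!mulrA mulrCA [n%:R / _]mulrC.
  rewrite ler_pM2l ?invr_gt0 //.
  set t := n%:R / M%:R in h2.
  have t0 : 0 <= t by rewrite /t divr_ge0.
  have t1 : t <= 1 by rewrite ler_pdivrMr // mul1r ler_nat ltnW.
  have -> : n%:R = t * M%:R by rewrite /t divfK // gt_eqF.
  rewrite mulrCA [t * _]mulrC ler_pM2l //.
  apply: (@le_trans _ _ (2 * (1 - (1 + t)^-1))); last by lra.
  have t3 : 1 + t != 0 by rewrite gt_eqF //; lra.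
  have -> : 1 - (1 + t)^-1 = t / (1 + t) by field.
  rewrite mulrA ler_pdivlMr; last by lra.
  nra.
have -> : \sum_(n < M) a n * (1 - (1 - N%:R^-1) ^+ n) =
  \sum_(0 <= n < M) a n * (1 - (1 - N%:R^-1) ^+ n) by rewrite big_mkord.
move=> H.
have W : \sum_(M <= n < L) a n * (1 - (1 - N%:R^-1) ^+ n) <= \sum_(M <= n < L) a n.
  apply: ler_sum => n _; rewrite ler_piMr // lerBlDr lerDl exprn_ge0 //.
have E : \sum_(n < L) a n - partial_gf p (1 - N%:R^-1) 1 L =
   \sum_(0 <= n < M) a n * (1 - (1 - N%:R^-1) ^+ n) +
   \sum_(M <= n < L) a n * (1 - (1 - N%:R^-1) ^+ n).
  rewrite -big_cat_nat //= big_mkord /partial_gf -sumrB.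
  by apply: eq_bigr => n _; rewrite mulrBr mulr1.
rewrite {1}/gf_gap; lra.
Qed.

End SizeDistribution.

(** * Lower bounds for the size distribution *)

(** The least positive difference of two elements of [B] divides every element of [S] by
Euclidean division, hence divides [h]; so [h] is itself such a difference, and it is
enough to correct multiples of a fixed element by at most as many copies of [h]. *)
Lemma additive_gcd_cofinite (S B : set nat) (h : nat) :
  is_gcd_set S h -> (exists2 b, S b & (0 < b)%N) ->
  S `<=` B -> B 0%N -> (forall x y, B x -> B y -> B (x + y)%N) ->
  exists N, forall n, (N <= n)%N -> (h %| n)%N -> B n.
Proof.
move=> [hS hmax] [b Sb b0] SB B0 Badd.
have Bmul k x : B x -> B (k * x)%N.
  by move=> Bx; elim: k => [|k IH]; [rewrite mul0n|rewrite mulSn; exact: Badd].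
pose D g := (0 < g)%N && `[< exists2 y, B y & B (y + g)%N >].
have exD : exists g, D g.
  by exists b; rewrite /D b0; apply/asboolP; exists 0%N => //; rewrite add0n; exact: SB.
have [g /andP[g0 /asboolP[y By Byg]] gmin] := ex_minnP exD.
have gS i : S i -> (g %| i)%N.
  move=> Si; rewrite /dvdn eqn0Ngt; apply/negP => r0.
  have /gmin : D (i %% g)%N.
    rewrite /D r0; apply/asboolP; exists ((i %/ g) * (y + g))%N; first exact: Bmul.
    have -> : ((i %/ g) * (y + g) + i %% g = i + (i %/ g) * y)%N.
      by rewrite mulnDr -addnA -divn_eq addnC.
    by apply: Badd; [exact: SB|exact: Bmul].
  by rewrite leqNgt ltn_pmod.
(* g divides h, so h itself is the difference of z + h and z, both in B. *)
have h0 : (0 < h)%N by rewrite (dvdn_gt0 b0) // hS.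
have /dvdnP[e he] := hmax _ gS.
have By' := Bmul e _ By; have := Bmul e _ Byg; rewrite mulnDr -he.
move: (e * y)%N By' => {By Byg} z Bz Bzh.
exists (h * z * z)%N => n + /dvdnP[m nE]; rewrite {n}nE.
have [z_eq0|z0] := posnP z.
  by move: Bzh; rewrite z_eq0 add0n => Bh _; exact: Bmul.
rewrite -mulnA mulnC leq_pmul2r // => mz.
(* m * h = (m / z) * h * z + r * h with r = m mod z, and r * h is r times the
   difference of z + h and z; the first term has at least r copies of z to give. *)
have qz : (z <= m %/ z)%N by rewrite leq_divRL.
rewrite (_ : m * h = (m %/ z * h - m %% z) * z + m %% z * (z + h))%N.
  by apply: Badd; exact: Bmul.
have lez : (m %% z <= m %/ z * h)%N.
  by apply: leq_trans (leq_trans (ltnW (ltn_pmod m z0)) qz) _; rewrite leq_pmulr.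
rewrite mulnDr addnA -mulnDl subnK // {1}(divn_eq m z) mulnDl.
by rewrite mulnAC.
Qed.


Section SubexponentialDecay.
Variables (R : realType) (p : nat -> R).
Hypothesis critp : critical_law p.

Let p_ge0 := critical_ge0 critp.
Let mass_le1 := critical_mass_le1 critp.
Local Notation a := (total_weight p 1).
Let a_ge0 n : 0 <= a n. Proof. exact: total_weight_ge0. Qed.

Lemma gf_gap_sqrt_le : exists2 C, 0 < C &
  forall M, (1 < M)%N -> gf_gap p M * Num.sqrt M%:R <= C.
Proof.
have [b b2 pb] := critical_branching critp.
exists (Num.sqrt (2 / p b)) => [|M M1]; first by rewrite sqrtr_gt0 divr_gt0.
have M0 : 0 < M%:R :> R by rewrite ltr0n ltnW.
have /andP[g0 _] := gf_gap_bounds critp (ltnW M1).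
rewrite -[gf_gap p M](ger0_norm g0) -sqrtr_sqr -sqrtrM ?sqr_ge0 // ler_wsqrtr //.
by rewrite -ler_pdivlMr // -mulrA -invfM; exact: gf_gap_sqr_le.
Qed.

Lemma gf_gap_sqrt_ge : exists2 c, 0 < c &
  \forall N \near \oo, c <= gf_gap p N * Num.sqrt N%:R.
Proof.
have [K K0 hK] := critical_second critp.
have [C C0 hC] := gf_gap_sqrt_le.
exists (Num.sqrt ((2 * K)^-1)); first by rewrite sqrtr_gt0 invr_gt0 mulr_gt0.
near=> N.
have N1 : (1 < N)%N by near: N; exact: nbhs_infty_gt.
have N0 : 0 < N%:R :> R by rewrite ltr0n ltnW.
have /andP[g0 _] := gf_gap_bounds critp (ltnW N1).
have gap : gf_gap p N <= 2^-1.
  have sN : 0 < Num.sqrt N%:R :> R by rewrite sqrtr_gt0.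
  rewrite -(ler_pM2r sN); apply: le_trans (hC _ N1) _.
  rewrite -ler_pdivrMl // invrK -[leLHS]ger0_norm; last by rewrite mulr_ge0 // ltW.
  rewrite -sqrtr_sqr ler_wsqrtr //.
  near: N; exact: nbhs_infty_ger.
rewrite -[gf_gap p N](ger0_norm g0) -sqrtr_sqr -sqrtrM ?sqr_ge0 // ler_wsqrtr //.
rewrite -ler_pdivrMr // -invfM; exact: (gf_gap_sqr_ge critp hK K0 (ltnW N1) gap).
Unshelve. all: by end_near. Qed.

(** The gap is of order [N ^ (-1/2)], so the sizes below [K] and those above [q ^ 4 * K]
together cannot account for the gap at [N = q ^ 2 * K] when [q] is large. *)
Lemma size_window : exists A c, [/\ (0 < A)%N, 0 < c &
  \forall K \near \oo, exists2 n, (K <= n < A * K)%N & c / K%:R ^+ 2 <= a n].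
Proof.
have [C C0 hC] := gf_gap_sqrt_le; have [c c0 [N0 _ hc]] := gf_gap_sqrt_ge.
(* In units of K ^ (-1/2) the window of ratio q ^ 4 receives at least
   c / q - 4 C / q ^ 2, which is c / (2 q) or more once 8 C / c <= q. *)
have [q hq] : exists q : nat, 8 * C / c <= q.+1%:R.
  exists (Num.truncn (8 * C / c)); apply: ltW.
  by rewrite truncnS_gt.
move: q.+1 (ltn0Sn q) hq => {}q q0 hq.
have qr : 0 < q%:R :> R by rewrite ltr0n.
exists (q ^ 4)%N, (c / (2 * q%:R) / (q ^ 4)%:R); split.
- by rewrite expn_gt0 q0.
- by rewrite !divr_gt0 ?mulr_gt0 // ltr0n expn_gt0 q0.
near=> K.
have K1 : (1 < K)%N by near: K; exact: nbhs_infty_gt.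
have K0 := ltnW K1.
have Kr : 0 < K%:R :> R by rewrite ltr0n.
have hN : c <= gf_gap p (q ^ 2 * K) * Num.sqrt (q ^ 2 * K)%:R.
  apply: hc => /=.
  apply: (@leq_trans K); last by rewrite leq_pmull // expn_gt0 q0.
  by near: K; exact: nbhs_infty_ge.
have hL := hC (q ^ 4 * K)%N; have hM := hC K K1.
have L1 : (1 < q ^ 4 * K)%N by apply: leq_trans K1 _; rewrite leq_pmull // expn_gt0 q0.
have {}hL := hL L1.
have KL : (0 < K <= q ^ 4 * K)%N by rewrite K0 leq_pmull // expn_gt0 q0.
have NN : (0 < q ^ 2 * K)%N by rewrite muln_gt0 expn_gt0 q0.
have W := gf_gap_le_window critp KL NN.
have sq : Num.sqrt (q ^ 2 * K)%:R = q%:R * Num.sqrt K%:R :> R.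
  by rewrite natrM natrX sqrtrM ?sqr_ge0 // sqrtr_sqr ger0_norm.
have sq4 : Num.sqrt (q ^ 4 * K)%:R = q%:R ^+ 2 * Num.sqrt K%:R :> R.
  rewrite natrM natrX (_ : 4 = 2 * 2)%N // exprM sqrtrM ?sqr_ge0 // sqrtr_sqr.
  by rewrite ger0_norm // sqr_ge0.
rewrite {}sq in hN; rewrite {}sq4 in hL.
set r : R := Num.sqrt K%:R in hN hL hM.
have r0 : 0 < r by rewrite sqrtr_gt0.
have rr : r * r = K%:R by rewrite -expr2 sqr_sqrtr // ltW.
have r1 : 1 <= r by rewrite -sqrtr1 ler_wsqrtr // ler1n.
set S := \sum_(K <= n < _) a n in W.
have S_ge : c / (2 * q%:R) <= S * r.
  have W' : gf_gap p (q ^ 2 * K) * (q%:R * r) * q%:R <=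
     2 * (gf_gap p (q ^ 4 * K) * (q%:R ^+ 2 * r)) + 2 * (gf_gap p K * r) +
     S * r * q%:R ^+ 2.
    have e : 2 * K%:R / (q ^ 2 * K)%:R = 2 / q%:R ^+ 2 :> R.
      by rewrite natrM natrX invfM mulrACA divff ?mulr1 // gt_eqF.
    rewrite e in W.
    have := ler_wpM2r (ltW (mulr_gt0 r0 (exprn_gt0 2 qr))) W.
    have qn0 : q%:R != 0 :> R by rewrite gt_eqF.
    rewrite -subr_ge0 => H; rewrite -subr_ge0; apply: le_trans H _.
    by rewrite le_eqVlt; apply/orP; left; apply/eqP; field.
  have H1 : c * q%:R <= 4 * C + S * r * q%:R ^+ 2.
    have := ler_wpM2r (ltW qr) hN; lra.
  have H2 : 8 * C <= q%:R * c by rewrite -ler_pdivrMr.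
  rewrite ler_pdivrMr; last by rewrite mulr_gt0.
  rewrite -(ler_pM2r qr); move: H1; set x := S * r => H1.
  rewrite expr2 in H1; lra.
apply: contrapT => /forall2NP none.
have : S <= \sum_(K <= n < q ^ 4 * K) c / (2 * q%:R) / (q ^ 4)%:R / K%:R ^+ 2.
  rewrite /S !big_nat; apply: ler_sum => n nK.
  by have [|/negP] := none n; [move/negP; rewrite nK|rewrite -ltNge => /ltW].
have S2 : c / (2 * q%:R) <= S * K%:R.
  apply: le_trans S_ge _; rewrite ler_wpM2l ?sumr_ge0 //.
  by rewrite -rr ler_peMl // ltW.
rewrite sumr_const_nat -[leRHS]mulr_natl natrB; last by case/andP: KL.
have k1 : K%:R != 0 :> R by rewrite gt_eqF.
have q4 : 0 < (q ^ 4)%:R :> R by rewrite ltr0n expn_gt0 q0.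
set e := c / (2 * q%:R) in S2 *.
have e0 : 0 < e by rewrite divr_gt0 // mulr_gt0.
have -> : ((q ^ 4 * K)%:R - K%:R) * (e / (q ^ 4)%:R / K%:R ^+ 2) =
   e / K%:R - e / (q ^ 4)%:R / K%:R :> R.
  by rewrite natrM; field; rewrite k1 gt_eqF.
rewrite -ler_pdivrMr // in S2 => S3.
have : 0 < e / (q ^ 4)%:R / K%:R by rewrite divr_gt0 // divr_gt0.
lra.
Unshelve. all: by end_near. Qed.

Variable h : nat.
Hypothesis hh : is_gcd_set [set i | (1 <= i)%N /\ 0 < p i] h.

(** One exploration step changes the number of trees minus the number of nodes by the
degree [d], a multiple of [h]. *)
Lemma total_weight_mod j n : 0 < total_weight p j n -> j = n %[mod h].
Proof.
have [hdvd _] := hh.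
elim: n j => [|n IH] [|j] //.
- by rewrite total_weight_short // ltxx.
- by rewrite total_weight0 ltxx.
rewrite total_weightSS => /lt0r_neq0/eqP/psumr_neq0P[d _|d /= pG].
  by rewrite mulr_ge0 // total_weight_ge0.
have pd : 0 < p d.
  by rewrite lt_neqAle p_ge0 andbT eq_sym; apply: contraTneq pG => ->; rewrite mul0r ltxx.
rewrite pmulr_rgt0 // in pG.
have hd : (h %| d)%N.
  by case: (posnP d) => [->|d0]; [exact: dvdn0|apply: hdvd].
move: (IH _ pG); rewrite -modnDmr (eqP hd) addn0 => jn.
by rewrite -(addn1 j) -(addn1 n) -modnDml jn modnDml.
Qed.

Lemma dvdn_total_weight n : 0 < a n.+1 -> (h %| n)%N.
Proof.
move=> /total_weight_mod /eqP; rewrite -{1}(addn0 1%N) -(add1n n) eqn_modDl.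
by rewrite mod0n eq_sym.
Qed.

Lemma total_weight_leaf_children i : 0 < p i -> 0 < a i.+1.
Proof.
move=> hpi; rewrite total_weightSS (bigD1 (@ord_max i)) //=.
have Gi : 0 < total_weight p i i.
  elim: {hpi} i => [|i IH]; first by rewrite total_weight0.
  rewrite -{1 2}(add1n i); apply: lt_le_trans (total_weight_mul_le p_ge0 1 i 1 i).
  by rewrite total_weight1_1 mulr_gt0 // (critical_zero critp).
rewrite ltr_pwDl ?mulr_gt0 ?add0n // sumr_ge0 // => d _.
by rewrite mulr_ge0 // total_weight_ge0.
Qed.

Lemma total_weight_gt0 : exists N, forall n, (N <= n)%N -> (h %| n)%N -> 0 < a n.+1.
Proof.
have [b b2 pb] := critical_branching critp.
apply: (@additive_gcd_cofinite _ [set n | 0 < a n.+1] h hh) => /=.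
- by exists b; [split => //; exact: ltnW|exact: ltnW].
- by move=> i [_ /total_weight_leaf_children].
- by rewrite total_weight1_1 (critical_zero critp).
- move=> x y x0 y0; apply: lt_le_trans (total_weight_supermul p_ge0 mass_le1 x y).
  exact: mulr_gt0.
Qed.

End SubexponentialDecay.

Section SubexponentialLowerBound.
Variables (R : realType) (p : nat -> R).
Hypothesis critp : critical_law p.
Variable h : nat.
Hypothesis hh : is_gcd_set [set i | (1 <= i)%N /\ 0 < p i] h.

Let p_ge0 := critical_ge0 critp.
Let mass_le1 := critical_mass_le1 critp.
Local Notation a := (total_weight p 1).
Let a_ge0 n : 0 <= a n. Proof. exact: total_weight_ge0. Qed.

(** Take a size of polynomially large probability in the window starting at [n / 2A] and
write the tree of [n] nodes as a graft of a tree of that size. *)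
Lemma total_weight_peel : exists (A : nat) (c : R), [/\ (0 < A)%N, 0 < c &
  \forall n \near \oo, 0 < a n -> exists2 m : nat,
    [/\ (m < n)%N, 0 < a m & m%:R <= (1 - (8 * A%:R)^-1 : R) * n%:R] &
    c / n%:R ^+ 2 * a m <= a n].
Proof.
have [A [c [A0 c0 [K1 _ win]]]] := size_window critp.
have [N2 pos] := total_weight_gt0 critp hh.
exists A, c; split => //; near=> n => an0.
pose K := (n %/ (2 * A))%N.
have A2 : (0 < 2 * A)%N by rewrite muln_gt0.
have KE : (n < K.+1 * (2 * A))%N by rewrite ltn_ceil.
have Kn : (K * (2 * A) <= n)%N by exact: leq_trunc_div.
have K1K : (K1 <= K)%N.
  rewrite leq_divRL //; near: n; exact: nbhs_infty_ge.
have K0 : (1 < K)%N.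
  rewrite leq_divRL //; near: n; exact: nbhs_infty_ge.
have n16 : (16 * A <= n)%N by near: n; exact: nbhs_infty_ge.
have nN2 : (2 * N2 <= n)%N by near: n; exact: nbhs_infty_ge.
have [[|k] /andP[Kk kA] ak] := win K K1K.
  by move: K0; rewrite ltnNge (leq_trans Kk).
have n0 : (0 < n)%N by apply: leq_trans n16; rewrite muln_gt0.
have [m nE] : exists m, n = m.+1 by exists n.-1; rewrite prednK.
move: {K1K} @K KE Kn K0 Kk kA ak; rewrite nE in n16 nN2 an0 * => K.
move: {K}(K) => K KE Kn K0 Kk kA ak.
have AK : (A * K * 2 <= m.+1)%N.
  by rewrite (_ : A * K * 2 = K * (2 * A))%N //; ring.
have km : (k <= m)%N by lia.
have ak0 : 0 < a k.+1.
  by apply: lt_le_trans ak; rewrite divr_gt0 // exprn_gt0 // ltr0n ltnW.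
have k8 : (m.+1 <= 8 * A * k)%N by nia.
exists (m - k).+1; first split.
- by lia.
- apply: pos; first by lia.
  by rewrite dvdn_sub // (dvdn_total_weight critp hh).
- rewrite -subSn // natrB; last by lia.
  rewrite mulrBl mul1r lerD2l lerN2 mulrC ler_pdivrMr ?mulr_gt0 ?ltr0n //.
  by rewrite -!natrM ler_nat mulnC.
apply: le_trans (_ : a k.+1 * a (m - k).+1 <= _).
  rewrite ler_wpM2r //; apply: le_trans ak.
  rewrite ler_pM2l // lef_pV2 ?posrE ?exprn_gt0 ?ltr0n ?(ltnW K0) //.
  rewrite ler_sqr ?nnegrE // ler_nat; nia.
by apply: le_trans (total_weight_supermul p_ge0 mass_le1 _ _) _; rewrite subnKC.
Unshelve. all: by end_near. Qed.

(** Repeated peeling divides the size by a constant factor at a polynomial cost, hence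
loses a factor exponential in the square of [ln n] only, which is subexponential in
every power of [n]. *)
Lemma total_weight_subexp (eps : R) : 0 < eps -> exists C : R,
  forall n, 0 < a n -> expR (- (C * n%:R `^ eps)) <= a n.
Proof.
move=> e0; have [A [c [A0 c0 [N _ peel]]]] := total_weight_peel.
pose t : R := 1 - (8 * A%:R)^-1.
have A8 : (1 : R) < 8 * A%:R.
  by have : (1 : R) <= A%:R; [rewrite ler1n|lra].
have t0 : 0 < t by rewrite subr_gt0 invf_lt1 //; lra.
have t1 : t < 1 by rewrite ltrBlDr ltrDl invr_gt0; lra.
have te1 : t `^ eps < 1.
  have <- : 1 `^ eps = 1 :> R by rewrite powR1.
  by rewrite gt0_ltr_powR ?nnegrE // ltW.
(* D (1 - t ^ eps) n ^ eps pays for the factor c / n ^ 2 lost in one peeling;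
   S takes care of the sizes below the threshold N. *)
pose D := (2 * eps^-1 + `|ln c|) / (1 - t `^ eps).
pose S := \sum_(n < N) `|ln (a n)|.
have S0 : 0 <= S by exact: sumr_ge0.
have i0 : 0 <= eps^-1 by rewrite invr_ge0 ltW.
have D0 : 0 <= D.
  by apply: divr_ge0; [rewrite addr_ge0 ?mulr_ge0|rewrite subr_ge0 ltW].
exists (D + S); elim/ltn_ind => n IH an0.
have n0 : (0 < n)%N.
  by case: n an0 {IH} => //; rewrite total_weight_short // ltxx.
have nr0 : 0 < n%:R :> R by rewrite ltr0n.
have ne1 : 1 <= n%:R `^ eps :> R.
  apply: (@le_trans _ _ (1 `^ eps)); first by rewrite powR1.
  by apply: ge0_ler_powR; rewrite ?nnegrE ?ler1n //; exact: ltW.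
rewrite -[leRHS]lnK ?posrE // ler_expR.
have [nN|Nn] := ltnP n N.
  have : `|ln (a n)| <= S.
    by rewrite /S (bigD1 (Ordinal nN)) //= lerDl sumr_ge0.
  have := ler_norm (- ln (a n)); rewrite normrN.
  have : S * 1 <= S * n%:R `^ eps by rewrite ler_wpM2l.
  have : 0 <= D * n%:R `^ eps by rewrite mulr_ge0 // powR_ge0.
  lra.
have [m [mn am0 mt] am] := peel n Nn an0.
have := IH m mn am0; rewrite -{1}[leRHS]lnK ?posrE // ler_expR => IHm.
have c1 : 0 < c / n%:R ^+ 2 by rewrite divr_gt0 // exprn_gt0.
have : ln (c / n%:R ^+ 2 * a m) <= ln (a n).
  by rewrite ler_ln ?posrE // mulr_gt0.
rewrite lnM ?posrE // ln_div ?posrE ?exprn_gt0 // lnXn // mulr2n => H.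
have mte : m%:R `^ eps <= t `^ eps * n%:R `^ eps.
  rewrite -powRM ?ler0n ?(ltW t0) // ge0_ler_powR ?nnegrE ?(ltW e0) //.
  by rewrite mulr_ge0 // ltW.
have lnn := ln_le_powR e0 nr0.
have lnc := ler_norm (- ln c); rewrite normrN in lnc.
have lncn : `|ln c| * 1 <= `|ln c| * n%:R `^ eps by rewrite ler_wpM2l.
have DE : D * (1 - t `^ eps) = 2 * eps^-1 + `|ln c|.
  by rewrite /D divfK // subr_eq0 gt_eqF.
have te0 : 0 <= t `^ eps by exact: powR_ge0.
set x := n%:R `^ eps in ne1 mte lnn lncn *.
have E : D * x = D * (t `^ eps) * x + (2 * eps^-1 + `|ln c|) * x.
  by rewrite -DE; ring.
have H1 : (D + S) * m%:R `^ eps <= (D + S) * (t `^ eps * x).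
  by rewrite ler_wpM2l // addr_ge0.
have H2 : S * (t `^ eps * x) <= S * x.
  by rewrite ler_wpM2l // ler_piMl ?ltW //; lra.
lra.
Qed.

End SubexponentialLowerBound.

(** * Node sets of plane trees *)

(** The addresses of the nodes of the trees [ts], the first of them being numbered [k]. *)
Fixpoint graft_nodes (N : plane_tree -> seq (seq nat)) (k : nat) (ts : forest) :=
  if ts is t :: ts' then [seq k :: v | v <- N t] ++ graft_nodes N k.+1 ts'
  else [::].

Fixpoint node_seq (t : plane_tree) : seq (seq nat) :=
  let: Node ts := t in [::] :: graft_nodes node_seq 0 ts.

Definition outdegree (t : plane_tree) (v : seq nat) : nat :=
  if fringe t v is Some s then size (children s) else 0%N.

Lemma mem_graft_nodes N k ts v :
  (v \in graft_nodes N k ts) =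
  (if v is i :: w then
     (k <= i)%N && (if onth ts (i - k) is Some c then w \in N c else false)
   else false).
Proof.
elim: ts k v => [|t ts IH] k v /=.
  by case: v => // i w; rewrite in_nil onth0n andbF.
rewrite mem_cat IH; case: v => [|i w].
  by rewrite orbF; apply/mapP => -[].
have [ki|ik|<-] := ltngtP k i.
- rewrite -[(i - k)%N]prednK ?subn_gt0 // -subnS orb_idl // => /mapP[v _ [e _]].
  by move: ki; rewrite e ltnn.
- by rewrite orbF; apply/mapP => -[v _ [e _]]; move: ik; rewrite e ltnn.
- rewrite orbF subnn /=; apply/mapP/idP => [[v vt [->]//]|wt]; by exists w.
Qed.

Lemma mem_node_seq t v : (v \in node_seq t) = fringe t v.
Proof.
elim: v t => [|i v IH] [ts] /=; first by rewrite mem_head.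
rewrite in_cons /= mem_graft_nodes subn0 /=.
by case: (onth ts i) => // c; rewrite IH.
Qed.

Lemma graft_nodes_uniq N k ts : {in ts, forall t, uniq (N t)} ->
  uniq (graft_nodes N k ts).
Proof.
elim: ts k => // t ts IH k uN; rewrite /= cat_uniq.
rewrite map_inj_uniq; last by move=> v w [].
rewrite uN ?mem_head // IH ?andbT /=; last first.
  by move=> s sts; apply: uN; rewrite in_cons sts orbT.
apply/hasPn => v; rewrite mem_graft_nodes; case: v => // i v /andP[ki _].
by apply/mapP => -[w _ [e _]]; move: ki; rewrite e ltnn.
Qed.

Lemma node_seq_uniq t : uniq (node_seq t).
Proof.
elim/plane_tree_nested_ind: t => ts IH /=.
by rewrite mem_graft_nodes /= graft_nodes_uniq.
Qed.

Lemma prod_graft_nodes (R : comPzSemiRingType) N k ts (F : seq nat -> R)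
    (H : plane_tree -> R) :
  (forall i c, onth ts i = Some c -> \prod_(w <- N c) F ((k + i)%N :: w) = H c) ->
  \prod_(v <- graft_nodes N k ts) F v = \prod_(c <- ts) H c.
Proof.
elim: ts k => [|t ts IH] k NH /=; first by rewrite !big_nil.
rewrite big_cat big_cons big_map; congr (_ * _).
  by rewrite -(NH 0%N t) // addn0.
by apply: IH => i c ic; rewrite addSnnS; exact: NH.
Qed.

Lemma tree_weight_nodes (R : realType) (p : nat -> R) t :
  tree_weight p t = \prod_(v <- node_seq t) p (outdegree t v).
Proof.
elim/plane_tree_nested_ind: t => ts IH; rewrite tree_weight_Node [node_seq _]/=.
rewrite big_cons /outdegree /=; congr (_ * _).
rewrite (@prod_graft_nodes _ _ _ _ _ (tree_weight p)) // => i c ic.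
rewrite IH; last by apply/onthP; exists i.
by apply: eq_bigr => w _; rewrite add0n /= ic.
Qed.

Lemma fringe_rcons t v i : fringe t (rcons v i) =
  if fringe t v is Some s then onth (children s) i else None.
Proof.
elim: v t => [|j v IH] t /=; first by case: (onth _ _).
by case: (onth _ _) => // c; exact: IH.
Qed.

Lemma tree_nodes_rcons t v i :
  tree_nodes t (rcons v i) <-> tree_nodes t v /\ (i < outdegree t v)%N.
Proof.
rewrite /tree_nodes /= fringe_rcons /outdegree; split.
  case: (fringe t v) => [s [c sc]|[//]]; split; first by exists s.
  by rewrite -onthTE sc.
move=> [[s ->]]; rewrite -onthTE; case: (onth _ _) => // c _.
by exists c.
Qed.

(** The set [gw_nodes X w], seen as a function of the degrees [X ^~ w] only. *)
Definition degree_nodes (f : seq nat -> nat) : set (seq nat) :=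
  [set u | forall j, (j < size u)%N -> (nth 0%N u j < f (take j u))%N].

Lemma degree_nodes_rcons f v i :
  degree_nodes f (rcons v i) <-> degree_nodes f v /\ (i < f v)%N.
Proof.
rewrite /degree_nodes /= size_rcons; split=> [H|[H iv] j].
  split=> [j jv|].
    have := H j (leqW jv).
    by rewrite nth_rcons jv -cats1 takel_cat // ltnW.
  have := H (size v) (ltnSn _).
  by rewrite nth_rcons ltnn eqxx -cats1 take_size_cat.
rewrite ltnS leq_eqVlt => /predU1P[->|jv].
  by rewrite nth_rcons ltnn eqxx -cats1 take_size_cat.
by rewrite nth_rcons jv -cats1 takel_cat ?H // ltnW.
Qed.

(** A word is a node as soon as its proper prefixes have enough children, so the degrees
at the nodes of [t] determine the whole node set. *)
Lemma degree_nodes_eq f t :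
  degree_nodes f = tree_nodes t <->
  (forall v, v \in node_seq t -> f v = outdegree t v).
Proof.
split=> [E v|fv].
  rewrite mem_node_seq => vt.
  have {}vt : tree_nodes t v.
    by rewrite /tree_nodes /=; case: (fringe t v) vt => // s _; exists s.
  have H i : (i < f v)%N = (i < outdegree t v)%N.
    apply/idP/idP => H.
      have : tree_nodes t (rcons v i) by rewrite -E degree_nodes_rcons E.
      by rewrite tree_nodes_rcons => -[].
    have : degree_nodes f (rcons v i) by rewrite E tree_nodes_rcons.
    by rewrite degree_nodes_rcons => -[].
  apply/eqP; rewrite eqn_leq; apply/andP; split; rewrite leqNgt.
    by rewrite H ltnn.
  by rewrite -H ltnn.
apply/seteqP; suff H v : degree_nodes f v <-> tree_nodes t v by split=> v /H.
elim/last_ind: v => [|v i IH].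
  by split=> // _; exists t.
rewrite degree_nodes_rcons tree_nodes_rcons IH.
suff : tree_nodes t v -> f v = outdegree t v by move=> H; split=> -[vt]; rewrite H.
by move=> [s vs]; apply: fv; rewrite mem_node_seq vs.
Qed.

Lemma tree_nodes_inj : injective tree_nodes.
Proof.
elim/plane_tree_nested_ind => ts IH [us] E.
have H i w : (if onth ts i is Some c then tree_nodes c w else False) <->
             (if onth us i is Some c then tree_nodes c w else False).
  have : tree_nodes (Node ts) (i :: w) <-> tree_nodes (Node us) (i :: w) by rewrite E.
  rewrite /tree_nodes /=; case: (onth ts i) => [c|]; case: (onth us i) => [c'|] //.
  - by move=> [H1 H2]; split=> // /H1[].
  - by move=> [H1 H2]; split=> // /H2[].
congr Node; apply: eq_from_onth => i; have := H i [::]; have := H i.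
case E1: (onth ts i) => [c|]; case E2: (onth us i) => [c'|] // {}H H0.
- congr Some; apply: IH; first by apply/onthP; exists i.
  by apply/seteqP; split=> w /H.
- by exfalso; apply: H0.1; exists c.
- by exfalso; apply: H0.2; exists c'.
Qed.

Definition trees (n : nat) : forest := [seq head (Node [::]) f | f <- forests 1 n].

Lemma forests1P n f : f \in forests 1 n -> f = [:: head (Node [::]) f].
Proof. by rewrite mem_forests => /andP[]; case: f => // t []. Qed.

Lemma mem_trees n t : (t \in trees n) = (tree_size t == n).
Proof.
apply/mapP/eqP => [[f fn ->]|tn].
  have := fn; rewrite (forests1P fn) mem_forests /fsize /= addn0.
  by move=> /eqP.
by exists [:: t] => //; rewrite mem_forests /fsize /= addn0 tn eqxx.
Qed.

Lemma trees_uniq n : uniq (trees n).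
Proof.
rewrite map_inj_in_uniq ?forests_uniq // => f g /forests1P fE /forests1P gE.
by rewrite {2}fE {2}gE => ->.
Qed.

Lemma sum_trees (R : realType) (p : nat -> R) n (Q : plane_tree -> Prop)
    (Q' : forest -> Prop) :
  (forall t, Q t <-> Q' [:: t]) ->
  \sum_(t <- trees n | `[< Q t >]) tree_weight p t =
  \sum_(f <- forests 1 n | `[< Q' f >]) forest_weight p f.
Proof.
move=> QQ; rewrite big_map big_mkcond [RHS]big_mkcond; apply: eq_big_seq => f.
move=> /forests1P ->; move: (head _ f) => t /=.
by rewrite (asbool_equiv_eq (QQ t)) /forest_weight big_seq1.
Qed.

(** * The law of the Galton-Watson tree *)

Section OffspringLaw.
Context d (Omega : measurableType d) (R : realType) (P : probability Omega R).
Variable xi : {RV P >-> nat}.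

Definition offspring_law (i : nat) : R := fine (P (xi @^-1` [set i])).

Lemma measurable_nat_preimage (Y : {RV P >-> nat}) (A : set nat) :
  measurable (Y @^-1` A).
Proof. exact: measurable_funPTI. Qed.

Lemma offspring_lawE i : P (xi @^-1` [set i]) = (offspring_law i)%:E.
Proof.
by rewrite fineK // fin_num_measure //; exact: measurable_nat_preimage.
Qed.

Lemma offspring_law_ge0 i : 0 <= offspring_law i.
Proof. exact: fine_ge0. Qed.

(** The sample space is partitioned by the values of [xi]. *)
Lemma integral_offspring (g : nat -> R) : (forall i, 0 <= g i) ->
  (\int[P]_w (g (xi w))%:E = \sum_(i <oo) (g i * offspring_law i)%:E)%E.
Proof.
move=> g0; pose F i := xi @^-1` [set i].
have FT : [set: Omega] = \bigcup_i F i.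
  by apply/esym/seteqP; split=> // w _; exists (xi w).
rewrite FT ge0_integral_bigcup.
- apply: eq_eseriesr => i _.
  rewrite (eq_integral (cst (g i)%:E)); last first.
    by move=> w; rewrite inE /F /= => ->.
  rewrite integral_cst; last exact: measurable_nat_preimage.
  by rewrite EFinM -offspring_lawE.
- by move=> k; exact: measurable_nat_preimage.
- rewrite -FT => _ Y mY; rewrite setTI.
  exact: (measurable_nat_preimage xi ((EFin \o g) @^-1` Y)).
- by move=> w _; rewrite lee_fin.
- by move=> i j _ _ [w [/= <- <-]].
Qed.

Lemma nneseries_cvg_sum (u : nat -> R) (l : R) : (forall i, 0 <= u i) ->
  (\sum_(i <oo) (u i)%:E = l%:E)%E -> (fun N => \sum_(i < N) u i) @ \oo --> l.
Proof.
move=> u0 ul.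
have : cvgn (fun n => \sum_(0 <= i < n) (u i)%:E)%E.
  by apply: is_cvg_nneseries => n _ _; rewrite lee_fin.
move=> /cvgP; rewrite ul => /fine_cvg.
by apply: cvg_trans; apply: near_eq_cvg; near=> n; rewrite /= sumEFin /= big_mkord.
Unshelve. all: by end_near. Qed.

Hypothesis hmean : ('E_P[fun w => (xi w)%:R] = 1)%E.
Hypothesis hvar0 : (0 < 'V_P[fun w => (xi w)%:R])%E.
Hypothesis hvar : ('V_P[fun w => (xi w)%:R] < +oo)%E.

Lemma offspring_law_mass : (fun N => \sum_(i < N) offspring_law i) @ \oo --> (1 : R).
Proof.
apply: nneseries_cvg_sum => //; first exact: offspring_law_ge0.
have := @integral_offspring (fun=> 1) (fun=> ler01).
have := expectation_cst P (1 : R); rewrite unlock /= => e0 e1.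
apply: etrans e0; rewrite e1.
by apply: eq_eseriesr => i _; rewrite mul1r.
Qed.

Lemma offspring_law_mean :
  (fun N => \sum_(i < N) i%:R * offspring_law i) @ \oo --> (1 : R).
Proof.
apply: (@nneseries_cvg_sum (fun i => i%:R * offspring_law i)) => [i|].
  by rewrite mulr_ge0 ?offspring_law_ge0.
move: hmean; rewrite unlock => <-.
by rewrite -(@integral_offspring (fun i => i%:R)).
Qed.

Lemma varianceE : ('V_P[fun w => (xi w)%:R] =
  \sum_(i <oo) ((i%:R - 1) ^+ 2 * offspring_law i)%:E)%E.
Proof.
rewrite -(@integral_offspring (fun i => (i%:R - 1) ^+ 2)); last first.
  by move=> i; exact: sqr_ge0.
rewrite /variance covariance.unlock hmean expectation.unlock.
by apply: eq_integral => w _; rewrite /= expr2.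
Qed.

Lemma critical_offspring_law : critical_law offspring_law.
Proof.
have p0 := offspring_law_ge0.
have mass := offspring_law_mass; have mean := offspring_law_mean.
have q0 i : 0 <= (i%:R - 1) ^+ 2 * offspring_law i by rewrite mulr_ge0 ?sqr_ge0.
pose q := offspring_law.
(* Without a degree above 1, mean 1 would force the law to be concentrated at 1,
   and the variance would vanish. *)
have branch : exists2 b, (2 <= b)%N & 0 < q b.
  apply: contrapT => /forall2NP none.
  have q2 i : (2 <= i)%N -> q i = 0.
    move=> i2; have [//|/negP] := none i; rewrite -leNgt => q0'.
    by apply/eqP; rewrite eq_le q0' p0.
  have q1 : q 1%N = 1.
    apply: (cvg_unique (@Rhausdorff R) _ mean).
    apply: cvg_near_cst; near=> N.
    have N2 : (2 <= N)%N by near: N; exact: nbhs_infty_ge.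
    rewrite (bigD1 (Ordinal N2)) //= mul1r big1 ?addr0 // => -[[|[|i]] iN] //= _.
      by rewrite mul0r.
    by rewrite -/q q2 // mulr0.
  have q0' : q 0%N = 0.
    apply/eqP; rewrite eq_le p0 andbT.
    have := partial_sum_le_lim p0 mass 2.
    by rewrite big_ord_recr big_ord1 /= -/q q1; lra.
  move: hvar0; rewrite varianceE eseries0 ?ltxx // => -[|[|i]] _ _.
  - by rewrite -/q q0' mulr0.
  - by rewrite subrr expr0n mul0r.
  - by rewrite -/q q2 // mulr0.
(* Without degree 0, a degree above 1 would push the mean above 1. *)
have zero : 0 < q 0%N.
  rewrite lt_neqAle p0 andbT eq_sym; apply/negP => /eqP z.
  have [b b2 qb] := branch.
  suff : q b <= 1 - 1 :> R by lra.
  have cD : (fun N => \sum_(i < N) i%:R * q i - \sum_(i < N) q i) @ \oo --> (1 - 1 : R).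
    exact: cvgB.
  rewrite -(cvg_lim (@Rhausdorff R) cD); apply: limr_ge; first exact: (cvgP _ cD).
  near=> N; rewrite /= -sumrB.
  have bN : (b < N)%N by near: N; exact: nbhs_infty_gt.
  rewrite (bigD1 (Ordinal bN)) //= -[leLHS]addr0 lerD //.
    have : 2 <= b%:R :> R by rewrite ler_nat.
    by move=> ?; nra.
  apply: sumr_ge0 => -[[|i] iN] _ /=; first by rewrite z mulr0 subr0.
  rewrite -[X in _ - X]mul1r -mulrBl mulr_ge0 // subr_ge0 ler1n //.
split => //.
have := hvar; rewrite varianceE.
set V := (\sum_(i <oo) _)%E => Vfin.
have V0 : (0 <= V)%E by apply: nneseries_ge0 => n _ _; rewrite lee_fin.
exists (2 * fine V + 2); first by rewrite ltr_wpDl // mulr_ge0 // fine_ge0.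
move=> N.
have VN : \sum_(i < N) (i%:R - 1) ^+ 2 * q i <= fine V.
  rewrite -lee_fin fineK; last by rewrite ge0_fin_numE.
  rewrite -sumEFin -(big_mkord xpredT (fun i => ((i%:R - 1) ^+ 2 * q i)%:E)).
  by apply: nneseries_lim_ge => n _ _; rewrite lee_fin.
have mN := partial_sum_le_lim p0 mass N.
(* i ^ 2 <= 2 (i - 1) ^ 2 + 2 turns the variance bound into one on the second
   moment. *)
apply: (@le_trans _ _ (\sum_(i < N) (2 * ((i%:R - 1) ^+ 2 * q i) + 2 * q i))).
  apply: ler_sum => i _; rewrite -/q.
  rewrite (_ : 2 * _ + _ = (2 * (i%:R - 1) ^+ 2 + 2) * q i); last by ring.
  rewrite ler_wpM2r //; have := sqr_ge0 (i%:R - 2 : R); rewrite !expr2; lra.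
rewrite big_split -!big_distrr /=; lra.
Unshelve. all: by end_near. Qed.

End OffspringLaw.

Section GaltonWatsonLaw.
Context d (Omega : measurableType d) (R : realType) (P : probability Omega R).
Variables (xi : {RV P >-> nat}) (X : seq nat -> {RV P >-> nat}).
Hypothesis hX : offspring_family xi X.
Local Notation p := (offspring_law xi).

Lemma gw_event1 t : gw_event X [set t] =
  \bigcap_(v in [set` node_seq t]) (X v @^-1` [set outdegree t v]).
Proof.
apply/seteqP; split=> w.
  by move=> [_ -> /(degree_nodes_eq (fun v => X v w)) H] v; exact: H.
by move=> H; exists t => //; apply/(degree_nodes_eq (fun v => X v w)) => v; exact: H.
Qed.

Lemma measurable_gw_event1 t : measurable (gw_event X [set t]).
Proof.
rewrite gw_event1; apply: fin_bigcap_measurable; first exact: finite_seq.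
by move=> v _; exact: measurable_nat_preimage.
Qed.

Lemma P_gw_event1 t : P (gw_event X [set t]) = (tree_weight p t)%:E.
Proof.
have [indep same] := hX.
rewrite gw_event1 (indep _ (fun v => [set outdegree t v]) (node_seq_uniq t)).
rewrite tree_weight_nodes -prodEFin; apply: eq_bigr => v _.
rewrite -offspring_lawE.
exact: (congr1 (fun m : set nat -> \bar R => m [set outdegree t v]) (same v)).
Qed.

Lemma gw_prob1 t : gw_prob X [set t] = tree_weight p t.
Proof. by rewrite /gw_prob P_gw_event1. Qed.

(** There are finitely many trees of a given size, and the events that the tree equals
each of them are disjoint; so the conditional laws reduce to finite sums. *)
Lemma gw_prob_size (A : set plane_tree) n :
  gw_prob X (A `&` [set t | tree_size t = n]) =
  \sum_(t <- trees n | `[< A t >]) tree_weight p t.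
Proof.
rewrite -big_filter; set s := [seq t <- trees n | _].
have us : uniq s by rewrite filter_uniq // trees_uniq.
have -> : gw_prob X (A `&` [set t | tree_size t = n]) =
    fine (P (\bigcup_(t in [set` s]) gw_event X [set t])).
  congr (fine (P _)); apply/seteqP; split=> w /=.
    move=> [t [At tn] wt]; exists t; last by exists t.
    by rewrite /= mem_filter mem_trees tn eqxx andbT; apply/asboolP.
  move=> [t /=]; rewrite mem_filter mem_trees => /andP[/asboolP At /eqP tn].
  by move=> [_ -> wt]; exists t.
rewrite measure_fin_bigcup //.
- rewrite -fsbig_seq //.
  rewrite (eq_bigr (fun t => (tree_weight p t)%:E)); first by rewrite sumEFin.
  by move=> t _; exact: P_gw_event1.
- exact: finite_seq.
- move=> t u _ _ [w [[_ -> wt] [_ -> wu]]].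
  by apply: tree_nodes_inj; rewrite -wt.
- by move=> t _; exact: measurable_gw_event1.
Qed.

Lemma gw_prob_sizeT n : gw_prob X [set t | tree_size t = n] = total_weight p 1 n.
Proof.
rewrite -[X in gw_prob _ X]setTI gw_prob_size.
rewrite (@sum_trees _ _ n [set: plane_tree] (fun=> True)) //.
by apply: eq_bigl => f; apply/asboolP.
Qed.

End GaltonWatsonLaw.

(** * Conditioned trees and the family of trees to be covered *)

Lemma seq_minimum (T : eqType) (R : realDomainType) (f : T -> R) (s : seq T) :
  s != [::] -> exists2 x, x \in s & forall y, y \in s -> f x <= f y.
Proof.
elim: s => // x [_ _|x' s IH _].
  by exists x; rewrite ?mem_head // => y; rewrite mem_seq1 => /eqP ->.
have [y ys ymin] := IH isT.
have [xy|yx] := leP (f x) (f y).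
  exists x; first exact: mem_head.
  by move=> z; rewrite in_cons => /predU1P[->//|/ymin]; exact: le_trans.
exists y; first by rewrite in_cons ys orbT.
by move=> z; rewrite in_cons => /predU1P[->|/ymin//]; exact: ltW.
Qed.

Section ConditionedTree.
Context d (Omega : measurableType d) (R : realType) (P : probability Omega R).
Variables (xi : {RV P >-> nat}) (X : seq nat -> {RV P >-> nat}).
Hypothesis hX : offspring_family xi X.
Local Notation p := (offspring_law xi).
Hypothesis critp : critical_law p.
Local Notation a := (total_weight p 1).

Let p_ge0 := critical_ge0 critp.
Let mass_le1 := critical_mass_le1 critp.
Let a_ge0 n : 0 <= a n. Proof. exact: total_weight_ge0. Qed.
Let w_ge0 t : 0 <= tree_weight p t. Proof. exact: tree_weight_ge0. Qed.

Lemma gw_condE (A : set plane_tree) n :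
  gw_cond X n A = (\sum_(t <- trees n | `[< A t >]) tree_weight p t) / a n.
Proof. by rewrite /gw_cond (gw_prob_size hX) (gw_prob_sizeT hX). Qed.

Lemma gw_cond_ge0 n A : 0 <= gw_cond X n A.
Proof. by rewrite gw_condE divr_ge0 // sumr_ge0. Qed.

Lemma gw_cond_mono n (A B : set plane_tree) :
  (forall t, tree_size t = n -> A t -> B t) -> gw_cond X n A <= gw_cond X n B.
Proof.
move=> AB; rewrite !gw_condE ler_wpM2r ?invr_ge0 //.
rewrite big_mkcond [leRHS]big_mkcond !big_seq; apply: ler_sum => t.
rewrite mem_trees => /eqP tn.
case: asboolP => [At|_]; last by case: ifP.
by rewrite (_ : `[< B t >]) //; apply/asboolP/AB.
Qed.

Lemma sum_trees_weight n : \sum_(t <- trees n) tree_weight p t = a n.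
Proof.
rewrite -(gw_prob_sizeT hX) -[X in gw_prob _ X]setTI (gw_prob_size hX).
by apply: eq_bigl => t; apply/esym/asboolP.
Qed.

Lemma gw_condU_le n (A B : set plane_tree) :
  gw_cond X n (A `|` B) <= gw_cond X n A + gw_cond X n B.
Proof.
rewrite !gw_condE -mulrDl ler_wpM2r ?invr_ge0 //.
rewrite big_mkcond [X in _ <= X + _]big_mkcond [X in _ <= _ + X]big_mkcond.
rewrite -big_split; apply: ler_sum => t _ /=.
case: asboolP => [[At|Bt]|_]; last by apply: addr_ge0; case: ifP.
  by rewrite (_ : `[< A t >]) ?lerDl; [case: ifP|apply/asboolP].
by rewrite (_ : `[< B t >]) ?lerDr; [case: ifP|apply/asboolP].
Qed.

Lemma gw_condC n A : 0 < a n -> gw_cond X n (~` A) = 1 - gw_cond X n A.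
Proof.
move=> an0; apply/eqP; rewrite eq_sym subr_eq !gw_condE -mulrDl.
rewrite big_mkcond [X in _ + X]big_mkcond -big_split /=.
rewrite (eq_bigr (tree_weight p)) => [|t _].
  by rewrite sum_trees_weight divff // gt_eqF.
by rewrite asbool_neg; case: asboolP => _; rewrite ?add0r ?addr0.
Qed.

Lemma tree_weight_le_total t : tree_weight p t <= a (tree_size t).
Proof.
rewrite -sum_trees_weight (bigD1_seq t) ?trees_uniq ?mem_trees //=.
by rewrite lerDl sumr_ge0.
Qed.

Lemma gw_cond_contains T n : 0 < tree_weight p T ->
  gw_cond X n [set t | contains_fringe t T] <=
  n%:R * tree_weight p T / a (tree_size T).
Proof.
move=> T0; have aT : 0 < a (tree_size T).
  exact: lt_le_trans T0 (tree_weight_le_total T).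
rewrite gw_condE.
rewrite (@sum_trees _ _ n [set t | contains_fringe t T] (fun f => fcontains f T));
  last by move=> t; rewrite fcontains_seq1.
have H := containing_weight_le p_ge0 T 1 n.
rewrite -ler_pdivlMr // in H.
have [->|an0] := eqVneq (a n) 0.
  by rewrite invr0 mulr0 divr_ge0 // mulr_ge0.
have an : 0 < a n by rewrite lt_neqAle eq_sym an0 a_ge0.
by rewrite ler_pdivrMr // mulrAC.
Qed.

Lemma gw_avoids_le T n :
  \sum_(t <- trees n | `[< ~ contains_fringe t T >]) tree_weight p t <=
  (1 - tree_weight p T) ^+ (n %/ tree_size T).
Proof.
apply: le_trans (avoiding_weight_le p_ge0 mass_le1 T 1 n).
rewrite (@sum_trees _ _ n (fun t => ~ contains_fringe t T) (fun f => ~ fcontains f T));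
  last by move=> t; rewrite fcontains_seq1.
by rewrite /avoiding_weight (eq_bigl (fun f => ~~ `[< fcontains f T >])) // => f;
  rewrite asbool_neg.
Qed.

Lemma SplusE k t : Splus X k t <-> (tree_size t <= k)%N /\ 0 < tree_weight p t.
Proof. by rewrite /Splus /= (gw_prob1 hX). Qed.

Lemma contains_all_le k l t : (k <= l)%N -> contains_all X l t -> contains_all X k t.
Proof.
by move=> kl H s /SplusE[sk s0]; apply: H; apply/SplusE; split=> //; exact: leq_trans kl.
Qed.

Definition splus_seq (k : nat) : forest :=
  [seq t <- flatten [seq trees i | i <- iota 0 k.+1] | 0 < tree_weight p t].

Lemma mem_splus_seq k t : t \in splus_seq k <-> Splus X k t.
Proof.
rewrite SplusE mem_filter; split=> [/andP[-> /flattenP[s /mapP[i + ->]]]|[tk ->]].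
  by rewrite mem_iota mem_trees leq0n add0n ltnS => ik /eqP ->.
rewrite andTb; apply/flattenP; exists (trees (tree_size t)); last by rewrite mem_trees.
by apply/map_f; rewrite mem_iota leq0n add0n ltnS.
Qed.

Lemma pminP k : (0 < k)%N -> exists T, [/\ Splus X k T, pmin X k = tree_weight p T &
  forall t, Splus X k t -> pmin X k <= tree_weight p t].
Proof.
move=> k0; have ne : splus_seq k != [::].
  have : Node [::] \in splus_seq k.
    apply/mem_splus_seq/SplusE; split => //.
    by rewrite /= big_nil mulr1 (critical_zero critp).
  by case: (splus_seq k).
have [T Tk Tmin] := seq_minimum (tree_weight p) ne.
rewrite /pmin; set A := [set _ | _ in _].
have AT : (A `&` lbound A) (tree_weight p T).
  split; first by exists T; [exact/mem_splus_seq|exact: gw_prob1].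
  by move=> _ [t /mem_splus_seq tk <-]; rewrite (gw_prob1 hX) Tmin.
have [[T' T'k TE] lb] := xgetPex 0 (ex_intro _ _ AT).
exists T'; split=> //; first by rewrite -TE (gw_prob1 hX).
by move=> t tk; apply: lb; exists t => //; exact: gw_prob1.
Qed.

Lemma pmin_gt0 k : (0 < k)%N -> 0 < pmin X k.
Proof. by move=> /pminP[T [/SplusE[_ T0] -> _]]. Qed.

(** A union bound over the trees to be covered. Their number is at most [1 / pmin X k],
because their probabilities, each at least [pmin X k], sum up to at most 1. *)
Lemma gw_cond_missing_le k n : (0 < k)%N -> 0 < a n ->
  gw_cond X n [set t | ~ contains_all X k t] <=
  expR (- (pmin X k * (n %/ k)%:R)) / (pmin X k * a n).
Proof.
move=> k0 an0; rewrite gw_condE invfM mulrA ler_pM2r ?invr_gt0 //.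
have q0 := pmin_gt0 k0; have [T [_ TE Tmin]] := pminP k0.
set q := pmin X k in q0 TE Tmin *.
have q1 : q <= 1.
  by rewrite TE (le_trans (tree_weight_le_total T)) // total_weight_le1.
have size_s : (size (splus_seq k))%:R <= q^-1.
  rewrite -[leRHS]mul1r ler_pdivlMr //.
  apply: le_trans (sum_total_weight_le1 p_ge0 mass_le1 1 k.+1).
  apply: (@le_trans _ _ (\sum_(t <- splus_seq k) tree_weight p t)).
    rewrite -sum1_size natr_sum big_distrl /= !big_seq; apply: ler_sum => t tk.
    by rewrite mul1r Tmin //; exact/mem_splus_seq.
  rewrite big_filter big_flatten big_map /=.
  rewrite -(big_mkord xpredT (fun i => a i)) /index_iota subn0.
  apply: (@le_trans _ _ (\sum_(j <- iota 0 k.+1) \sum_(t <- trees j) tree_weight p t)).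
    apply: ler_sum => i _.
    by rewrite big_mkcond; apply: ler_sum => t _; case: ifP.
  by apply: ler_sum => i _; rewrite sum_trees_weight.
apply: (@le_trans _ _ (\sum_(T <- splus_seq k) expR (- (q * (n %/ k)%:R)))); last first.
  rewrite big_const_seq count_predT iter_addr_0 -[leLHS]mulr_natl [leRHS]mulrC.
  by rewrite ler_wpM2r ?expR_ge0.
apply: (@le_trans _ _ (\sum_(T <- splus_seq k)
   \sum_(t <- trees n | `[< ~ contains_fringe t T >]) tree_weight p t)).
  under [leRHS]eq_bigr do rewrite big_mkcond.
  rewrite exchange_big /= big_mkcond; apply: ler_sum => t _.
  case: asboolP => [/existsNP[T' /not_implyP[/mem_splus_seq T'k nT']]|_]; last first.
    by apply: sumr_ge0 => T' _; case: ifP.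
  rewrite (big_rem T') //= (_ : `[< _ >]); last exact/asboolP.
  by rewrite lerDl; apply: sumr_ge0 => T'' _; case: ifP.
rewrite !big_seq; apply: ler_sum => T' /mem_splus_seq T'k.
apply: le_trans (gw_avoids_le _ _) _.
have qT := Tmin _ T'k; have [sT _] := (SplusE _ _).1 T'k.
have wT1 : tree_weight p T' <= 1.
  by rewrite (le_trans (tree_weight_le_total T')) // total_weight_le1.
apply: (@le_trans _ _ ((1 - q) ^+ (n %/ tree_size T'))).
  by rewrite lerXn2r ?nnegrE ?subr_ge0 // lerD2l lerN2.
apply: (@le_trans _ _ ((1 - q) ^+ (n %/ k))).
  rewrite ler_wiXn2l ?subr_ge0 //; first by rewrite gerBl ltW.
  by rewrite leq_div2l ?tree_size_gt0.
rewrite -mulNr mulrC expRM_natl lerXn2r ?nnegrE ?subr_ge0 ?expR_ge0 //.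
by have := expR_ge1Dx (- q).
Qed.

(** Already the least probable tree is unlikely to be found. Its size may be smaller than
[k]; the bound then holds a fortiori, being monotone in the size. *)
Lemma gw_cond_contains_all_le k n (C e : R) : (0 < k)%N -> 0 <= e ->
  (forall n, 0 < a n -> expR (- (C * n%:R `^ e)) <= a n) ->
  gw_cond X n [set t | contains_all X k t] <=
  n%:R * pmin X k * expR (`|C| * k%:R `^ e).
Proof.
move=> k0 e0 hC; have [T [Tk TE _]] := pminP k0; have [sT T0] := (SplusE _ _).1 Tk.
apply: (@le_trans _ _ (gw_cond X n [set t | contains_fringe t T])).
  by apply: gw_cond_mono => t _; apply.
apply: le_trans (gw_cond_contains _ T0) _; rewrite TE ler_wpM2l ?mulr_ge0 //.
have aT : 0 < a (tree_size T) by exact: lt_le_trans T0 (tree_weight_le_total T).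
rewrite -[leRHS]invrK lef_pV2 ?posrE ?invr_gt0 ?expR_gt0 // -expRN.
apply: le_trans (hC _ aT); rewrite ler_expR lerN2.
apply: (@le_trans _ _ (`|C| * (tree_size T)%:R `^ e)).
  by rewrite ler_wpM2r ?powR_ge0 // ler_norm.
by rewrite ler_wpM2l // ge0_ler_powR ?nnegrE // ler_nat.
Qed.

End ConditionedTree.

(** * Asymptotics of the threshold *)

Section ThresholdAsymptotics.
Variables (R : realType) (alpha beta gamma : R).
Hypotheses (alpha1 : 1 <= alpha) (beta0 : 0 <= beta) (gamma0 : 0 < gamma).

Let alpha0 : 0 < alpha. Proof. exact: lt_le_trans alpha1. Qed.
Let alphaN0 : alpha != 0. Proof. exact: lt0r_neq0. Qed.

(** The assumed growth of [ln (1 / pmin X k)]. *)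
Definition log_cost (k : nat) : R := gamma * k%:R `^ alpha * ln k%:R `^ beta.

Local Notation theta := (threshold alpha beta gamma).
Local Notation lnL n := (ln (ln n%:R `^ alpha^-1) : R).

Lemma log_cost_ge0 k : 0 <= log_cost k.
Proof. by rewrite /log_cost !mulr_ge0 ?powR_ge0 // ltW. Qed.

Lemma near_ln_ge (M : R) : \forall n \near \oo, M <= ln n%:R.
Proof.
near=> n; have Mn : expR M <= n%:R by near: n; exact: nbhs_infty_ger.
by rewrite -[M]expRK ler_ln ?posrE ?expR_gt0 // (lt_le_trans _ Mn) ?expR_gt0.
Unshelve. all: by end_near. Qed.

Lemma near_le_log_cost : \forall k \near \oo, gamma * k%:R <= log_cost k.
Proof.
near=> k; have k1 : 1 <= k%:R :> R by rewrite ler1n; near: k; exact: nbhs_infty_gt.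
have l1 : 1 <= ln k%:R :> R by near: k; exact: near_ln_ge.
rewrite /log_cost -mulrA ler_pM2l // -[leLHS]mulr1 ler_pM //.
  by apply: le1r_powR.
by apply: le_trans (ler_powR l1 beta0); rewrite powRr0.
Unshelve. all: by end_near. Qed.

Lemma near_lnL_ge (M : R) : \forall n \near \oo, M <= lnL n.
Proof.
near=> n; have Mn : expR (alpha * M) <= ln n%:R by near: n; exact: near_ln_ge.
rewrite ln_powR ler_pdivlMl // -[leLHS]expRK ler_ln ?posrE ?expR_gt0 //.
by rewrite (lt_le_trans _ Mn) ?expR_gt0.
Unshelve. all: by end_near. Qed.

Lemma powR_rootK (y : R) : 0 <= y -> (y `^ alpha^-1) `^ alpha = y.
Proof. by move=> y0; rewrite -powRrM mulVf // powRr1. Qed.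

Lemma threshold_powR n : 0 < ln n%:R :> R ->
  theta n `^ alpha = ln n%:R / (gamma * lnL n `^ beta).
Proof.
by move=> m0; rewrite powR_rootK // divr_ge0 ?mulr_ge0 ?powR_ge0 // ltW.
Qed.

Lemma threshold_gt0 n : 0 < ln n%:R :> R -> 0 < lnL n -> 0 < theta n.
Proof.
by move=> m0 x0; rewrite powR_gt0 // divr_gt0 // mulr_gt0 // powR_gt0.
Qed.

(** By definition [theta n `^ alpha] is [ln n / (gamma * lnL n `^ beta)]. For
[beta > 0] a size below [theta n] eventually has a logarithm below [lnL n], so the
powers of logarithms cancel in the right direction, and [(1 - delta) `^ alpha <= 1 - delta]. *)
Lemma near_log_cost_le delta : 0 < delta -> delta < 1 ->
  \forall n \near \oo, forall k, (0 < k)%N ->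
    k%:R <= (1 - delta) * theta n -> log_cost k <= (1 - delta) * ln n%:R.
Proof.
move=> d0 d1; near=> n => k k0 kt.
have m0 : 0 < ln n%:R :> R.
  by apply: (@lt_le_trans _ _ 1) => //; near: n; exact: near_ln_ge.
have x0 : 0 < lnL n.
  by apply: (@lt_le_trans _ _ 1) => //; near: n; exact: near_lnL_ge.
have xb : 0 < lnL n `^ beta by exact: powR_gt0.
have t0 := threshold_gt0 m0 x0.
have kr : 0 < k%:R :> R by rewrite ltr0n.
have H1 : k%:R `^ alpha <= (1 - delta) * (ln n%:R / (gamma * lnL n `^ beta)).
  rewrite -threshold_powR //.
  apply: (@le_trans _ _ (((1 - delta) * theta n) `^ alpha)).
    by rewrite ge0_ler_powR ?nnegrE ?(ltW alpha0) // mulr_ge0 ?subr_ge0 // ltW.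
  rewrite powRM ?subr_ge0 ?(ltW d1) ?(ltW t0) // ler_wpM2r ?powR_ge0 //.
  by rewrite ge1r_powR //; apply/andP; split; lra.
have H2 : ln k%:R `^ beta <= lnL n `^ beta.
  have [->|bn0] := eqVneq beta 0; first by rewrite !powRr0.
  have bp : 0 < beta by rewrite lt_neqAle eq_sym bn0.
  have lk0 : 0 <= ln k%:R :> R by rewrite ln_ge0 // ler1n.
  rewrite ge0_ler_powR ?nnegrE ?(ltW x0) //.
  rewrite ler_ln ?posrE ?powR_gt0 //; apply: le_trans kt _.
  apply: (@le_trans _ _ (theta n)).
    by rewrite ler_piMl ?ltW //; lra.
  rewrite /threshold ge0_ler_powR ?nnegrE ?invr_ge0 ?divr_ge0 ?mulr_ge0
    ?powR_ge0 ?(ltW alpha0) ?(ltW gamma0) ?(ltW m0) //.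
  rewrite ler_pdivrMr ?mulr_gt0 // ler_peMr ?(ltW m0) //.
  have : gamma^-1 `^ beta^-1 <= lnL n by near: n; exact: near_lnL_ge.
  move=> H; rewrite -ler_pdivrMl // mulr1.
  rewrite (_ : gamma^-1 = (gamma^-1 `^ beta^-1) `^ beta); last first.
    by rewrite -powRrM mulVf // powRr1 // invr_ge0 ltW.
  by rewrite ge0_ler_powR ?nnegrE ?powR_ge0 ?(ltW x0).
rewrite /log_cost.
apply: (@le_trans _ _ (gamma * ((1 - delta) * (ln n%:R / (gamma * lnL n `^ beta)))
    * lnL n `^ beta)).
  by rewrite ler_pM ?mulr_ge0 ?powR_ge0 ?(ltW gamma0) // ler_pM2l.
rewrite le_eqVlt; apply/orP; left; apply/eqP; field.
by rewrite !gt_eqF.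
Unshelve. all: by end_near. Qed.

(** Up to powers of [ln (ln n)], [theta n] is [ln n `^ alpha^-1]. *)
Lemma near_ln_threshold_ge (r : R) : r < 1 ->
  \forall n \near \oo, r * lnL n <= ln (theta n).
Proof.
move=> r1.
(* With x = lnL n, alpha * ln (theta n) = alpha x - ln gamma - beta ln x, and
   beta ln x <= beta (e x - ln e) takes at most half of the room (1 - r) alpha x. *)
pose e := (1 - r) * alpha / (2 * (beta + 1)).
have b1 : 0 < beta + 1 by rewrite ltr_wpDl.
have e0 : 0 < e by rewrite divr_gt0 ?mulr_gt0 // subr_gt0.
near=> n.
have m0 : 0 < ln n%:R :> R.
  by apply: (@lt_le_trans _ _ 1) => //; near: n; exact: near_ln_ge.
have x0 : 0 < lnL n.
  by apply: (@lt_le_trans _ _ 1) => //; near: n; exact: near_lnL_ge.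
have xb : 0 < lnL n `^ beta by exact: powR_gt0.
have lnt : alpha * ln (theta n) =
    alpha * lnL n - (ln gamma + beta * ln (lnL n)).
  have -> : alpha * lnL n = ln (ln n%:R) by rewrite ln_powR mulVKf.
  have -> : theta n = (ln n%:R / (gamma * lnL n `^ beta)) `^ alpha^-1 by [].
  move: (lnL n) x0 xb => x x0 xb.
  rewrite ln_powR mulVKf // ln_div ?posrE ?mulr_gt0 //.
  by rewrite lnM ?posrE // ln_powR.
rewrite -(ler_pM2l alpha0) lnt.
have lx : ln (lnL n) <= e * lnL n - ln e.
  rewrite lerBrDr -lnM ?posrE // mulrC; apply/ltW/ln_sublinear.
  exact: mulr_gt0.
have lx' : beta * ln (lnL n) <= beta * (e * lnL n - ln e) by rewrite ler_wpM2l.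
have be : beta * e <= (1 - r) * alpha / 2.
  have -> : (1 - r) * alpha / 2 = (beta + 1) * e.
    by rewrite /e; field; rewrite gt_eqF.
  by rewrite ler_wpM2r ?(ltW e0) //; lra.
have bex : beta * e * lnL n <= (1 - r) * alpha / 2 * lnL n.
  by rewrite ler_wpM2r // ltW.
have ra : 0 < (1 - r) * alpha / 2 by rewrite !mulr_gt0 ?subr_gt0 ?invr_gt0.
have : (ln gamma - beta * ln e) / ((1 - r) * alpha / 2) <= lnL n.
  by near: n; exact: near_lnL_ge.
rewrite ler_pdivrMr //; lra.
Unshelve. all: by end_near. Qed.

(** Same computation as below the threshold, but the powers of logarithms only cancel
up to a factor close to 1, as [ln (theta n)] is merely equivalent to [lnL n]. *)
Lemma near_log_cost_ge delta : 0 < delta ->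
  \forall n \near \oo, forall k, (1 + delta) * theta n <= k%:R ->
    (1 + delta / 2) * ln n%:R <= log_cost k.
Proof.
move=> d0.
pose s := (1 + delta / 2) / (1 + delta).
have s0 : 0 < s by rewrite divr_gt0; lra.
have s1 : s < 1 by rewrite ltr_pdivrMr; lra.
(* r < 1 is close enough to 1 for (1 + delta) * r ^ beta to be at least
   1 + delta / 2. *)
have [r [r0 r1 rs]] : exists r : R, [/\ 0 < r, r < 1 & s <= r `^ beta].
  have [->|bn0] := eqVneq beta 0.
    by exists 2^-1; rewrite powRr0; split; lra.
  have bp : 0 < beta by rewrite lt_neqAle eq_sym bn0.
  exists (s `^ beta^-1); rewrite powR_gt0 // -powRrM mulVf // powRr1 ?(ltW s0) //.
  split => //; rewrite -ltr_ln ?posrE ?powR_gt0 // ln1 ln_powR.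
  by rewrite pmulr_rlt0 ?invr_gt0 // ln_lt0 // s0.
near=> n => k kt.
have m0 : 0 < ln n%:R :> R.
  by apply: (@lt_le_trans _ _ 1) => //; near: n; exact: near_ln_ge.
have x0 : 0 < lnL n.
  by apply: (@lt_le_trans _ _ 1) => //; near: n; exact: near_lnL_ge.
have xb : 0 < lnL n `^ beta by exact: powR_gt0.
have t0 := threshold_gt0 m0 x0.
have lnt : r * lnL n <= ln (theta n) by near: n; exact: near_ln_threshold_ge.
have tk : theta n <= k%:R.
  by apply: le_trans kt; rewrite ler_peMl ?ltW //; lra.
have H1 : (1 + delta) * (ln n%:R / (gamma * lnL n `^ beta)) <= k%:R `^ alpha.
  rewrite -threshold_powR //.
  apply: (@le_trans _ _ (((1 + delta) * theta n) `^ alpha)); last first.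
    rewrite ge0_ler_powR ?nnegrE ?(ltW alpha0) // mulr_ge0 ?(ltW t0) //; lra.
  rewrite powRM ?(ltW t0) //; last by lra.
  by rewrite ler_wpM2r ?powR_ge0 // le1r_powR //; lra.
have H2 : s * lnL n `^ beta <= ln k%:R `^ beta.
  apply: (@le_trans _ _ ((r * lnL n) `^ beta)).
    by rewrite powRM ?(ltW r0) ?(ltW x0) // ler_wpM2r ?powR_ge0.
  have rx : 0 <= r * lnL n by rewrite mulr_ge0 ?ltW.
  have lnk : r * lnL n <= ln k%:R.
    by apply: le_trans lnt _; rewrite ler_ln ?posrE // (lt_le_trans t0).
  by rewrite ge0_ler_powR ?nnegrE // (le_trans rx).
rewrite /log_cost.
apply: (@le_trans _ _ (gamma * ((1 + delta) * (ln n%:R / (gamma * lnL n `^ beta)))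
    * (s * lnL n `^ beta))).
  rewrite le_eqVlt; apply/orP; left; apply/eqP; rewrite /s; field.
  by rewrite !gt_eqF //=; lra.
have d1 : 0 <= 1 + delta by lra.
have q0 : 0 <= ln n%:R / (gamma * lnL n `^ beta).
  by rewrite divr_ge0 ?mulr_ge0 ?powR_ge0 ?(ltW gamma0) ?(ltW m0).
apply: ler_pM => //; last by rewrite ler_pM2l.
  exact: mulr_ge0 (ltW gamma0) (mulr_ge0 d1 q0).
exact: mulr_ge0 (ltW s0) (powR_ge0 _ _).
Unshelve. all: by end_near. Qed.

Lemma near_threshold_ge (M : R) : \forall n \near \oo, M <= theta n.
Proof.
near=> n.
have m0 : 0 < ln n%:R :> R.
  by apply: (@lt_le_trans _ _ 1) => //; near: n; exact: near_ln_ge.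
have x0 : 0 < lnL n.
  by apply: (@lt_le_trans _ _ 1) => //; near: n; exact: near_lnL_ge.
have t0 := threshold_gt0 m0 x0.
have lnt : 2^-1 * lnL n <= ln (theta n).
  by near: n; apply: near_ln_threshold_ge; lra.
have lt := ln_sublinear t0.
have : 2 * M <= lnL n by near: n; exact: near_lnL_ge.
lra.
Unshelve. all: by end_near. Qed.

End ThresholdAsymptotics.

(** * Convergence below and above the threshold *)

Instance infty_mod1_filter h : Filter (infty_mod1 h).
Proof. exact: within_filter. Qed.

Lemma near_infty_mod1 h (Q : nat -> Prop) :
  (\forall n \near \oo, Q n) -> \forall n \near infty_mod1 h, Q n.
Proof. by move=> H; apply: filterS H => n Qn _. Qed.

Lemma cvg0_of_le_exp_ln (R : realType) h (f : nat -> R) (c : R) : 0 < c ->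
  (forall n, 0 <= f n) ->
  (\forall n \near infty_mod1 h, f n <= expR (- (c * ln n%:R))) ->
  f n @[n --> infty_mod1 h] --> (0 : R).
Proof.
move=> c0 f0 fle; apply/cvgr0Pnorm_le => eps eps0; near=> n.
rewrite ger0_norm //.
have fn : f n <= expR (- (c * ln n%:R)) by near: n.
apply: le_trans fn _; rewrite -[leRHS]lnK ?posrE // ler_expR lerNl -ler_pdivrMl //.
near: n; apply: near_infty_mod1; exact: near_ln_ge.
Unshelve. all: by end_near. Qed.

Section FringeThreshold.
Context d (Omega : measurableType d) (R : realType) (P : probability Omega R).
Variables (xi : {RV P >-> nat}) (X : seq nat -> {RV P >-> nat}).
Hypothesis hX : offspring_family xi X.
Local Notation p := (offspring_law xi).
Hypothesis critp : critical_law p.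
Local Notation a := (total_weight p 1).
Variable h : nat.
Hypothesis hh : is_gcd_set [set i | (1 <= i)%N /\ 0 < p i] h.
Variables (alpha beta gamma : R).
Hypotheses (alpha1 : 1 <= alpha) (beta0 : 0 <= beta) (gamma0 : 0 < gamma).
Hypothesis hpmin : (fun k : nat => ln (1 / pmin X k)) ~_\oo
  (fun k : nat => gamma * k%:R `^ alpha * (ln k%:R) `^ beta).
Local Notation theta := (threshold alpha beta gamma).
Local Notation cost := (log_cost alpha beta gamma).

Lemma near_total_weight_gt0 : \forall n \near infty_mod1 h, 0 < a n.
Proof.
have [N pos] := total_weight_gt0 critp hh.
exists N.+1 => //= -[//|n] /= Nn n1; apply: pos => //.
by move/eqP: n1; rewrite -add1n -[X in _ == X %[mod _]]addn0 eqn_modDl mod0n.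
Qed.

Lemma near_ln_pmin (eta : R) : 0 < eta -> \forall k \near \oo,
  (1 - eta) * cost k <= - ln (pmin X k) <= (1 + eta) * cost k.
Proof.
move=> e0; move/eqaddoP: hpmin => /(_ _ e0) H.
near=> k.
have k0 : (0 < k)%N by near: k; exact: nbhs_infty_gt.
have : `|ln (1 / pmin X k) - cost k| <= eta * `|cost k|.
  by near: k; exact: H.
rewrite div1r lnV ?posrE ?(pmin_gt0 hX critp k0) //.
rewrite (ger0_norm (log_cost_ge0 alpha beta gamma0 k)) ler_norml => /andP[H1 H2].
by apply/andP; split; lra.
Unshelve. all: by end_near. Qed.

(** With [y = n ^ (delta / 8)], [pmin * n] is at least [y ^ 4] and [k] at most of order
[ln n], hence of order [y]: the union bound has an exponent at most of order [- y ^ 3],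
against which the factors [1 / pmin] and [1 / a n], of exponent of order [y], are
negligible. *)
Lemma gw_cond_missing_cvg (k : nat -> nat) (delta : R) :
  (forall n, (0 < k n)%N) -> k n @[n --> infty_mod1 h] --> \oo ->
  0 < delta ->
  (\forall n \near infty_mod1 h, (k n)%:R <= (1 - delta) * theta n) ->
  gw_cond X n [set t | ~ contains_all X (k n) t] @[n --> infty_mod1 h] --> (0 : R).
Proof.
move=> k0 koo d0 kle.
(* For delta >= 1 no n satisfies the bound on k n, so the filter contains the
   empty set and every convergence holds. *)
have [d1|d1] := ltP delta 1; last first.
  suff E : \forall n \near infty_mod1 h, False.
    by move=> A _; apply: filterS E.
  apply: filterS kle => n kn.
  have : (k n)%:R <= 0 :> R.
    apply: le_trans kn _; rewrite mulr_le0_ge0 ?powR_ge0 //; lra.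
  by rewrite lern0 => /eqP kn0; have := k0 n; rewrite kn0.
pose e := delta / 8.
have e0 : 0 < e by rewrite divr_gt0.
have [C hC] := total_weight_subexp critp hh e0.
have near_k (Q : nat -> Prop) : (\forall l \near \oo, Q l) ->
    \forall n \near infty_mod1 h, Q (k n) by move=> HQ; exact: (koo Q).
have d20 : 0 < delta / 2 by rewrite divr_gt0.
(* Once y = n ^ e exceeds B, a term of order y ^ 3 beats all those of order y. *)
pose B := 2 / (gamma * e) * (2 / e + `|C|) + 2 / (gamma * e) + 1.
apply: (@cvg0_of_le_exp_ln _ _ _ 1) => // [n|]; first exact: (gw_cond_ge0 hX critp).
near=> n.
have an0 : 0 < a n by near: n; exact: near_total_weight_gt0.
apply: le_trans (gw_cond_missing_le hX critp (k0 n) an0) _.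
have q0 := pmin_gt0 hX critp (k0 n).
have m1 : 1 <= ln n%:R :> R.
  by near: n; apply: near_infty_mod1; exact: near_ln_ge.
have mB : B / e <= ln n%:R :> R.
  by near: n; apply: near_infty_mod1; exact: near_ln_ge.
have n0 : 0 < n%:R :> R.
  rewrite ltr0n; near: n; apply: near_infty_mod1; exact: nbhs_infty_gt.
have costk : cost (k n) <= (1 - delta) * ln n%:R.
  have : (k n)%:R <= (1 - delta) * theta n by near: n.
  move: (k n) (k0 n).
  by near: n; apply: near_infty_mod1; exact: near_log_cost_le.
have gk : gamma * (k n)%:R <= cost (k n).
  by near: n; apply: near_k (near_le_log_cost alpha1 beta0 gamma0).
have lnq : - ln (pmin X (k n)) <= (1 + delta / 2) * cost (k n).
  have /andP[_ ->//] : (1 - delta / 2) * cost (k n) <= - ln (pmin X (k n))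
      <= (1 + delta / 2) * cost (k n).
  by near: n; exact: (near_k _ (near_ln_pmin d20)).
have nE : n%:R = expR (ln n%:R) :> R by rewrite lnK ?posrE.
have my := ln_le_powR e0 n0.
have an := hC n an0.
have yE : n%:R `^ e = expR (e * ln n%:R) :> R by rewrite {1}nE -expRM mulrC.
move: (k0 n) costk gk lnq.
set q := pmin X (k n) in q0 *; move: (k n) => l l0 costk gk lnq.
set m : R := ln n%:R in m1 mB costk my yE nE *.
set y : R := n%:R `^ e in my an yE.
have lnq2 : - ln q <= (1 - delta / 2) * m.
  apply: le_trans lnq _.
  have : (1 + delta / 2) * cost l <= (1 + delta / 2) * ((1 - delta) * m).
    by rewrite ler_wpM2l //; lra.
  have : 0 <= delta * delta * m by rewrite !mulr_ge0 //; lra.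
  lra.
have qn : y ^+ 4 <= q * n%:R.
  rewrite -[q]lnK ?posrE // nE -expRD yE -expRM_natl ler_expR.
  rewrite /e; lra.
have ge0 : 0 < gamma * e by rewrite mulr_gt0.
have B1 : 0 <= 2 / (gamma * e) * (2 / e + `|C|).
  by rewrite mulr_ge0 ?addr_ge0 ?divr_ge0 // ltW.
have B2 : 0 <= 2 / (gamma * e) by rewrite divr_ge0 // ltW.
have yB : B <= y.
  rewrite yE; apply: le_trans (expR_ge1Dx _).
  by rewrite ler_pdivrMr // mulrC in mB; apply: le_trans mB _; rewrite lerDr.
have y1 : 1 <= y by rewrite /B in yB; lra.
have y0 : 0 < y by lra.
have yn : y ^+ 2 <= n%:R.
  rewrite nE yE -expRM_natl ler_expR /e.
  have : delta * m <= 1 * m by rewrite ler_wpM2r //; lra.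
  lra.
have lr : 0 < l%:R :> R by rewrite ltr0n.
have lm : l%:R <= gamma^-1 * m.
  rewrite ler_pdivlMl //; apply: le_trans gk _; apply: le_trans costk _.
  by rewrite ler_piMl //; lra.
have ly : l%:R <= y / (gamma * e).
  apply: le_trans lm _; rewrite (_ : y / (gamma * e) = gamma^-1 * (e^-1 * y)).
    by rewrite ler_wpM2l // invr_ge0 ltW.
  by rewrite invfM mulrCA [y * _]mulrC.
have l2n : 2 * l%:R <= n%:R :> R.
  apply: le_trans yn; apply: (@le_trans _ _ (2 / (gamma * e) * y)).
    by rewrite -mulrA ler_wpM2l // mulrC.
  by rewrite expr2 ler_wpM2r ?(ltW y0) //; move: yB; rewrite /B; lra.
have div : n%:R / (2 * l%:R) <= (n %/ l)%:R :> R.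
  rewrite ler_pdivrMr ?mulr_gt0 // -!natrM ler_nat.
  by apply: leq_divn_mul2 => //; move: l2n; rewrite -natrM ler_nat.
have key : gamma * e / 2 * y ^+ 3 <= q * (n %/ l)%:R.
  apply: (@le_trans _ _ (q * (n%:R / (2 * l%:R)))); last first.
    by rewrite ler_wpM2l // ltW.
  rewrite [leRHS]mulrA ler_pdivlMr ?mulr_gt0 //; apply: le_trans qn.
  rewrite [leLHS](_ : _ = gamma * e * l%:R * y ^+ 3); last by field.
  rewrite [leRHS]exprS ler_wpM2r ?exprn_ge0 ?(ltW y0) //.
  by rewrite mulrC -ler_pdivlMr.
have yy : 2 / e + `|C| <= gamma * e / 2 * y ^+ 2.
  rewrite -ler_pdivrMl ?divr_gt0 // invf_div.
  apply: (@le_trans _ _ y); first by move: yB; rewrite /B; lra.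
  by rewrite expr2 ler_peMl // ltW.
have key2 : 2 * m + `|C| * y <= q * (n %/ l)%:R.
  apply: le_trans key; rewrite exprSr mulrA.
  apply: (@le_trans _ _ ((2 / e + `|C|) * y)); last by rewrite ler_wpM2r // ltW.
  by rewrite [leRHS]mulrDl lerD2r -mulrA ler_wpM2l.
rewrite ler_pdivrMr ?mulr_gt0 // mul1r.
apply: (@le_trans _ _ (expR (- m) * (expR (ln q) * expR (- (C * y))))); last first.
  rewrite ler_pM2l ?expR_gt0 // (lnK (_ : q \in Num.pos)) ?posrE //.
  by rewrite ler_pM2l.
rewrite -!expRD ler_expR.
have Cy : C * y <= `|C| * y by rewrite ler_wpM2r ?ler_norm // ltW.
have dm : 0 <= delta * m by rewrite mulr_ge0 // ltW //; lra.
lra.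
Unshelve. all: by end_near. Qed.

(** The correction [exp (|C| k ^ (1/2))] coming from the size distribution is negligible,
as [ln (1 / pmin X k)] grows at least linearly. *)
Lemma gw_cond_contains_all_cvg (k : nat -> nat) (delta : R) :
  (forall n, (0 < k n)%N) -> k n @[n --> infty_mod1 h] --> \oo ->
  0 < delta ->
  (\forall n \near infty_mod1 h, (1 + delta) * theta n <= (k n)%:R) ->
  gw_cond X n [set t | contains_all X (k n) t] @[n --> infty_mod1 h] --> (0 : R).
Proof.
move=> k0 koo d0 kge.
have near_k (Q : nat -> Prop) : (\forall l \near \oo, Q l) ->
    \forall n \near infty_mod1 h, Q (k n) by move=> HQ; exact: (koo Q).
have half0 : 0 < 2^-1 :> R by [].
have [C hC] := total_weight_subexp critp hh half0.
have dd : 0 < 1 + delta / 2 by lra.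
(* eta is spent twice, on the asymptotics of pmin and on the factor
   exp (|C| k ^ (1/2)); together they use delta / 4 of the gain delta / 2. *)
have [eta [eta0 etaE]] : exists eta : R, 0 < eta /\ eta * (1 + delta / 2) = delta / 8.
  exists (delta / (8 * (1 + delta / 2))); split.
    by rewrite divr_gt0 // mulr_gt0.
  by rewrite invfM -!mulrA mulVf ?mulr1 // gt_eqF.
apply: (@cvg0_of_le_exp_ln _ _ _ (delta / 4)); first by rewrite divr_gt0.
  by move=> n; exact: (gw_cond_ge0 hX critp).
near=> n.
apply: le_trans (gw_cond_contains_all_le hX critp n (k0 n) (ltW half0) hC) _.
have q0 := pmin_gt0 hX critp (k0 n).
have m1 : 1 <= ln n%:R :> R.
  by near: n; apply: near_infty_mod1; exact: near_ln_ge.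
have n0 : 0 < n%:R :> R.
  rewrite ltr0n; near: n; apply: near_infty_mod1; exact: nbhs_infty_gt.
have costk : (1 + delta / 2) * ln n%:R <= cost (k n).
  have : (1 + delta) * theta n <= (k n)%:R by near: n.
  move: (k n).
  by near: n; apply: near_infty_mod1; exact: near_log_cost_ge.
have gk : gamma * (k n)%:R <= cost (k n).
  by near: n; apply: near_k (near_le_log_cost alpha1 beta0 gamma0).
have lnq : (1 - eta) * cost (k n) <= - ln (pmin X (k n)).
  have /andP[->//] : (1 - eta) * cost (k n) <= - ln (pmin X (k n))
      <= (1 + eta) * cost (k n).
  by near: n; exact: (near_k _ (near_ln_pmin eta0)).
have kC : (`|C| / (eta * gamma)) ^+ 2 <= (k n)%:R.
  near: n; apply: (near_k (fun l => (`|C| / (eta * gamma)) ^+ 2 <= l%:R)).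
  exact: nbhs_infty_ger.
move: costk gk lnq kC.
set q := pmin X (k n) in q0 *; move: (k n) => l costk gk lnq kC.
rewrite powR12_sqrt //.
set s := Num.sqrt l%:R.
have s0 : 0 <= s by exact: sqrtr_ge0.
have sE : s * s = l%:R by rewrite -expr2 sqr_sqrtr.
have eg : 0 < eta * gamma by rewrite mulr_gt0.
have Cs : `|C| <= eta * gamma * s.
  rewrite mulrC -ler_pdivrMr //.
  have c0 : 0 <= `|C| / (eta * gamma) by rewrite divr_ge0 // ltW.
  by rewrite -[leLHS](ger0_norm c0) -[`|_ / _|]sqrtr_sqr ler_wsqrtr.
have Css : `|C| * s <= eta * cost l.
  apply: (@le_trans _ _ (eta * gamma * s * s)); first by rewrite ler_wpM2r.
  by rewrite -!mulrA sE ler_wpM2l // ltW.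
set m : R := ln n%:R in m1 costk *.
have -> : n%:R = expR m :> R by rewrite lnK ?posrE.
rewrite -[q]lnK ?posrE // -!expRD ler_expR.
have H1 : (1 - 2 * eta) * ((1 + delta / 2) * m) <= (1 - 2 * eta) * cost l.
  have e1 : eta * (1 + delta / 2) <= 2^-1 * (1 + delta / 2) by rewrite etaE; lra.
  by rewrite ler_wpM2l // subr_ge0; rewrite ler_pM2r // in e1; lra.
have H2 : (1 - 2 * eta) * ((1 + delta / 2) * m) = (1 + delta / 4) * m.
  rewrite mulrA mulrBl -mulrA etaE; lra.
lra.
Unshelve. all: by end_near. Qed.

End FringeThreshold.

(** * The largest covered size *)

Lemma contains_fringe_size t s : contains_fringe t s -> (tree_size s <= tree_size t)%N.
Proof.
elim/plane_tree_nested_ind: t => ts IH.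
move=> /contains_fringe_Node[<- //|[t tts /(IH _ tts) st]].
apply: leq_trans st _; rewrite /= leqW //.
by rewrite (perm_sumn (perm_map tree_size (perm_to_rem tts))) /= leq_addr.
Qed.

Section MaximalSize.
Context d (Omega : measurableType d) (R : realType) (P : probability Omega R).
Variables (xi : {RV P >-> nat}) (X : seq nat -> {RV P >-> nat}).
Hypothesis hX : offspring_family xi X.
Local Notation p := (offspring_law xi).
Hypothesis critp : critical_law p.
Local Notation a := (total_weight p 1).
Variable h : nat.
Hypothesis hh : is_gcd_set [set i | (1 <= i)%N /\ 0 < p i] h.

(** There are trees of positive probability with more nodes than [t], so the sizes covered
by [t] are bounded. *)
Lemma KmaxP t : contains_all X (Kmax X t) t /\
  forall k, contains_all X k t -> (k <= Kmax X t)%N.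
Proof.
have [N pos] := total_weight_gt0 critp hh.
pose n := (h * maxn N (tree_size t).+1)%N.
have h0 : (0 < h)%N.
  have [b b2 pb] := critical_branching critp.
  by apply: (@dvdn_gt0 _ b); [exact: ltnW|apply: hh.1; split => //; exact: ltnW].
have Nn : (maxn N (tree_size t).+1 <= n)%N by rewrite leq_pmull.
have [s sn s0] : exists2 s, tree_size s = n.+1 & 0 < tree_weight p s.
  have := pos n (leq_trans (leq_maxl _ _) Nn) (dvdn_mulr _ (dvdnn h)).
  rewrite -(sum_trees_weight hX) => /lt0r_neq0/eqP.
  apply: contra_notP => /forall2NP none; rewrite big_seq big1 // => s.
  rewrite mem_trees => /eqP sn; have [//|/negP] := none s.
  rewrite -leNgt => s0; apply/eqP; rewrite eq_le s0.
  exact: tree_weight_ge0 (critical_ge0 critp) s.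
have bound k : `[< contains_all X k t >] -> (k <= n)%N.
  move=> /asboolP kt; rewrite leqNgt; apply/negP => nk.
  have /contains_fringe_size : contains_fringe t s.
    by apply: kt; apply/(SplusE hX); rewrite sn.
  by rewrite sn leqNgt ltnS ltnW // (leq_trans _ Nn) // leq_maxr.
have ex0 : exists k, `[< contains_all X k t >].
  exists 0%N; apply/asboolP => u /(SplusE hX)[].
  by rewrite leqNgt tree_size_gt0.
have [m /asboolP mt mmax] := ex_maxnP ex0 bound.
rewrite /Kmax; set A := [set k | _].
have mA : (A `&` ubound A) m by split=> // k /asboolP; exact: mmax.
by have [KA Kub] := xgetPex 0%N (ex_intro _ m mA); split.
Qed.

Lemma le_Kmax t k : (k <= Kmax X t)%N <-> contains_all X k t.
Proof.
have [Kt Kmax_ge] := KmaxP t; split=> [kK|/Kmax_ge//].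
exact: contains_all_le hX _ _ _ kK Kt.
Qed.
End MaximalSize.

Theorem theorem5 (R : realType) (d : measure_display)
    (Omega : measurableType d) (P : probability Omega R)
    (xi : {RV P >-> nat}) (X : seq nat -> {RV P >-> nat})
    (h : nat) (alpha beta gamma : R)
    (hmean : ('E_P[fun w => (xi w)%:R] = 1)%E)
    (hvar0 : (0 < 'V_P[fun w => (xi w)%:R])%E)
    (hvar : ('V_P[fun w => (xi w)%:R] < +oo)%E)
    (hX : offspring_family xi X)
    (hh : is_gcd_set
            [set i | (1 <= i)%N /\ (0 < P [set w | xi w = i])%E] h)
    (halpha : 1 <= alpha) (hbeta : 0 <= beta) (hgamma : 0 < gamma)
    (hpmin : (fun k : nat => ln (1 / pmin X k)) ~_\oo
             (fun k : nat => gamma * k%:R `^ alpha * (ln k%:R) `^ beta)) :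
  (forall (k : nat -> nat) (delta : R),
      (forall n, (0 < k n)%N) ->
      k n @[n --> infty_mod1 h] --> \oo ->
      0 < delta ->
      ((\forall n \near infty_mod1 h,
          (k n)%:R <= (1 - delta) * threshold alpha beta gamma n) ->
       gw_cond X n [set t | contains_all X (k n) t] @[n --> infty_mod1 h]
         --> (1 : R))
      /\
      ((\forall n \near infty_mod1 h,
          (1 + delta) * threshold alpha beta gamma n <= (k n)%:R) ->
       gw_cond X n [set t | ~ contains_all X (k n) t] @[n --> infty_mod1 h]
         --> (1 : R)))
  /\
  (forall eps : R, 0 < eps ->
     gw_cond X n
       [set t | eps < `| (Kmax X t)%:R /
                           ((ln n%:R / (ln (ln n%:R)) `^ beta) `^ alpha^-1)
                         - ((alpha `^ beta) / gamma) `^ alpha^-1 |]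
       @[n --> infty_mod1 h] --> (0 : R)).
Proof.
have critp : critical_law (offspring_law xi) by exact: critical_offspring_law.
have {}hh : is_gcd_set [set i | (1 <= i)%N /\ 0 < offspring_law xi i] h.
  rewrite (_ : [set i | _] = [set i | (1 <= i)%N /\ (0 < P [set w | xi w = i])%E]) //.
  by apply/seteqP; split=> i /=;
    rewrite -lte_fin -offspring_lawE.
have missing := gw_cond_missing_cvg hX critp hh halpha hbeta hgamma hpmin.
have containing := gw_cond_contains_all_cvg hX critp hh halpha hbeta hgamma hpmin.
have apos := near_total_weight_gt0 critp hh.
split=> [k delta k0 koo d0|eps eps0].
  split=> kd.
    have := missing k delta k0 koo d0 kd => M.
    have : (1 - gw_cond X n [set t | ~ contains_all X (k n) t])
        @[n --> infty_mod1 h] --> (1 - 0 : R) by apply: cvgB => //; exact: cvg_cst.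
    rewrite subr0; apply: cvg_trans; apply: near_eq_cvg; near=> n.
    have an0 : 0 < total_weight (offspring_law xi) 1 n by near: n.
    by rewrite (gw_condC hX [set t | contains_all X (k n) t] an0) opprB addrC subrK.
  have := containing k delta k0 koo d0 kd => M.
  have : (1 - gw_cond X n [set t | contains_all X (k n) t])
      @[n --> infty_mod1 h] --> (1 - 0 : R) by apply: cvgB => //; exact: cvg_cst.
  rewrite subr0; apply: cvg_trans; apply: near_eq_cvg; near=> n.
  have an0 : 0 < total_weight (offspring_law xi) 1 n by near: n.
  exact/esym/(gw_condC hX [set t | contains_all X (k n) t] an0).
pose c := ((alpha `^ beta) / gamma) `^ alpha^-1.
pose th := threshold alpha beta gamma.
have alpha0 : 0 < alpha by exact: lt_le_trans halpha.
have c0 : 0 < c by rewrite powR_gt0 // divr_gt0 // powR_gt0.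
(* A deviation of more than eps is one by a factor 1 + 2 dl or 1 - 2 dl of theta;
   kp and km are integers at relative distance at least dl from theta on either
   side, and the bound 1/2 keeps km unbounded. *)
pose dl := Num.min (eps / (2 * c)) 2^-1.
have dl0 : 0 < dl by rewrite lt_min divr_gt0 //= mulr_gt0.
have dlh : dl <= 2^-1 by rewrite ge_min lexx orbT.
have dle : 2 * dl * c <= eps.
  have : dl <= eps / (2 * c) by rewrite ge_min lexx.
  by rewrite ler_pdivlMr ?mulr_gt0 // mulrA [dl * 2]mulrC.
pose kp n := (Num.truncn ((1 + 2 * dl) * th n)).+1.
pose km n := maxn 1 (Num.truncn ((1 - dl) * th n)).
have thoo (M : R) : \forall n \near infty_mod1 h, M <= th n.
  by apply: near_infty_mod1; exact: near_threshold_ge.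
have thE : \forall n \near infty_mod1 h,
    th n = c * (ln n%:R / (ln (ln n%:R)) `^ beta) `^ alpha^-1.
  near=> n.
  have m1 : 1 <= ln n%:R :> R.
    by near: n; apply: near_infty_mod1; exact: near_ln_ge.
  have l0 : 0 <= ln (ln n%:R) :> R by exact: ln_ge0.
  have lb0 : 0 < ln (ln n%:R) `^ beta :> R.
    rewrite powR_gt0 // ln_gt0 // (lt_le_trans (_ : 1 < 2)) ?ltr1n //.
    by near: n; apply: near_infty_mod1; exact: near_ln_ge.
  have ab0 : 0 < alpha `^ beta by exact: powR_gt0.
  have E : ln n%:R / (gamma * ln (ln n%:R `^ alpha^-1) `^ beta) =
      alpha `^ beta / gamma * (ln n%:R / ln (ln n%:R) `^ beta).
    rewrite ln_powR powRM ?invr_ge0 ?(ltW alpha0) //.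
    rewrite -(powR_inv1 (ltW alpha0)) -powRrM mulN1r powRN; field.
    by rewrite !gt_eqF.
  rewrite /th /threshold E powRM // divr_ge0 ?powR_ge0 ?(ltW hgamma) //.
  exact: le_trans m1.
have kpgt n : (1 + 2 * dl) * th n < (kp n)%:R by exact: truncnS_gt.
have kpoo : kp n @[n --> infty_mod1 h] --> \oo.
  apply/cvgnyPge => A; near=> n.
  have tA : A%:R <= th n by near: n.
  have t0 : 0 <= th n by near: n.
  rewrite -(ler_nat R); apply: le_trans tA _; apply: le_trans (ltW (kpgt n)).
  by rewrite ler_peMl //; lra.
have kmoo : km n @[n --> infty_mod1 h] --> \oo.
  apply/cvgnyPge => A; near=> n.
  have tA : 2 * A%:R <= th n by near: n.
  have t0 : 0 <= th n by near: n.
  rewrite leq_max truncn_ge_nat; last by rewrite mulr_ge0 //; lra.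
  apply/orP; right; have : 2^-1 * th n <= (1 - dl) * th n by rewrite ler_wpM2r //; lra.
  lra.
have Hp : gw_cond X n [set t | contains_all X (kp n) t]
    @[n --> infty_mod1 h] --> (0 : R).
  apply: (containing kp (2 * dl)) => //; first by rewrite mulr_gt0.
  by near=> n; exact: ltW.
have Hm : gw_cond X n [set t | ~ contains_all X (km n) t]
    @[n --> infty_mod1 h] --> (0 : R).
  apply: (missing km dl) => //; first by move=> n; rewrite leq_max.
  near=> n; have t2 : 2 <= th n by near: n.
  have t1 : 1 <= (1 - dl) * th n.
    have : 2^-1 * th n <= (1 - dl) * th n by rewrite ler_wpM2r //; lra.
    lra.
  rewrite /km; case: leqP => // _.
  by rewrite truncn_le; lra.
have Hpm : (gw_cond X n [set t | contains_all X (kp n) t] +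
    gw_cond X n [set t | ~ contains_all X (km n) t]) @[n --> infty_mod1 h] --> (0 : R).
  by rewrite -[X in _ --> X]addr0; exact: cvgD.
apply: (squeeze_cvgr _ (cvg_cst 0) Hpm); near=> n.
rewrite (gw_cond_ge0 hX critp) /=.
apply: le_trans (gw_condU_le hX critp _ _ _).
apply: (gw_cond_mono hX critp) => t _ /=; rewrite -/c.
have tE : th n = c * (ln n%:R / (ln (ln n%:R)) `^ beta) `^ alpha^-1 by near: n.
have t1 : dl^-1 <= th n by near: n.
have t0 : 0 < th n by apply: lt_le_trans t1; rewrite invr_gt0.
set D := _ `^ alpha^-1 in tE *.
have D0 : 0 < D by rewrite tE pmulr_rgt0 in t0.
have dlD : 2 * dl * th n <= eps * D by rewrite tE mulrA ler_pM2r.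
rewrite lter_normr => /orP[Kgt|Klt]; [left|right].
  apply/(le_Kmax hX critp hh); rewrite /kp -(ltr_nat R).
  apply: le_lt_trans (_ : (1 + 2 * dl) * th n < _).
    by rewrite truncn_le mulr_ge0 ?(ltW t0) //; lra.
  have : (c + eps) * D < (Kmax X t)%:R by rewrite -ltr_pdivlMr //; lra.
  rewrite mulrDl -tE; lra.
move=> /(le_Kmax hX critp hh) kK.
have : (Kmax X t)%:R < (c - eps) * D by rewrite -ltr_pdivrMr //; lra.
have : (Num.truncn ((1 - dl) * th n))%:R <= (Kmax X t)%:R :> R.
  by rewrite ler_nat (leq_trans _ kK) // leq_maxr.
have := truncnS_gt ((1 - dl) * th n); rewrite -natr1.
have : 1 <= dl * th n by rewrite mulrC -ler_pdivrMr // div1r.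
rewrite [(c - eps) * D]mulrBl -tE; lra.
Unshelve. all: by end_near. Qed.
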